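(* Let $\mu$ be a doubling measure on $X$ and $\Omega$ supports a local $\Phi$-Poincaré inequality for some N-function $\Phi\in\Delta'\cap\nabla_2$. For every $m\in\mathbb N$, let $(Y_m,d_m)$ be a complete metric space, $K_m\subset Y_m$ compact and $\{u_m\}\subset M^{1,\Phi}(\Omega,Y_m)$. Suppose that $(K_m,d_m)$ is a uniformly compact sequence and \begin{equation*} \sup_{m\in\mathbb N}\left[\|d_m(y_m,u_m)\|_{L^\Phi(\Omega)}+E_H^\Phi(u_m)\right]<\infty \end{equation*} for some and thus every $y_m\in K_m$. Then, after possibly passing to a subsequence, there exist a complete metric space $Z$, isometric embeddings $\varphi_m\colon Y_m\hookrightarrow Z$, a compact subset $K\subset Z$ and $v\in M^{1,\Phi}(\Omega,Z)$ such that $\varphi_m(K_m)\subset K$ for all $m\in\mathbb N$ and $\varphi_m\circ u_m$ converges to $v$ in $L^\Phi(\Omega,Z)$.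
   Context: Setting: $X=(X,d_X,\mu)$ complete metric measure space, $\Omega\subset X$ bounded domain; $\mu$ doubling means $0<\mu(B(x,2r))\le C_d\mu(B(x,r))<\infty$. An N-function is a continuous even convex $\Phi\colon\mathbb R\to[0,\infty)$ with $\Phi(x)=0$ iff $x=0$, $\Phi(x)/x\to0$ as $x\to0$, $\to\infty$ as $x\to\infty$. $\Phi\in\Delta'$: $\Phi(xy)\le C'\Phi(x)\Phi(y)$; $\Phi\in\nabla_2$: $\Phi(x)\le\frac1{2C}\Phi(Cx)$ for some $C>1$. Local $\Phi$-Poincaré inequality: there are $C_\Phi>0,\lambda\ge1$ such that $\frac{1}{\mu(B)}\int_B|u-u_B|\,d\mu\le C_\Phi r\,\Phi^{-1}\!\left(\frac{1}{\mu(\lambda B)}\int_{\lambda B}\Phi(g)\,d\mu\right)$ for every integrable $u$, every upper gradient $g$, and each ball $B=B(x,r)$ with $\lambda B\subset\Omega$, $u_B=\frac1{\mu(B)}\int_Bu\,d\mu$. $L^\Phi$ carries the Luxemburg norm. $M^{1,\Phi}(\Omega,Y)$ consists of measurable $u\in L^\Phi(\Omega,Y)$ for which there exists $0\le g\in L^\Phi(\Omega)$ with $d_Y(u(x),u(x'))\le d_X(x,x')(g(x)+g(x'))$ for all $x,x'$ outside a $\mu$-null set; $E_H^\Phi(u)=\inf_g\|g\|_{L^\Phi(\Omega)}$ over such $g$. Uniformly compact: $\sup_m\operatorname{diam}K_m<\infty$ and for each $\varepsilon>0$ there is $N$ such that every $K_m$ is covered by at most $N$ balls of radius $\varepsilon$.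 *)

(* Defs.v *)
From HB Require Import structures.
From mathcomp Require Import all_boot all_order all_algebra.
From mathcomp Require Import all_classical all_reals all_analysis.
From mathcomp Require Import measurable_realfun.
Set Implicit Arguments. Unset Strict Implicit. Unset Printing Implicit Defensive.
Import Order.TTheory GRing.Theory Num.Theory.
Import numFieldNormedType.Exports.
Local Open Scope classical_set_scope.
Local Open Scope ring_scope.

Section MetricDefs.
Variable R : realType.

Definition is_metric (T : Type) (d : T -> T -> R) : Prop :=
  (forall x y, 0 <= d x y) /\ (forall x y, d x y = 0 <-> x = y) /\
  (forall x y, d x y = d y x) /\ (forall x y z, d x z <= d x y + d y z).

Definition complete_metric (T : Type) (d : T -> T -> R) : Prop :=
  forall u : nat -> T,
    (forall e, 0 < e -> exists N, forall n m, (N <= n)%N -> (N <= m)%N -> d (u n) (u m) < e) ->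
    exists l, (fun n => d (u n) l) @ \oo --> (0 : R).

Definition mball (T : Type) (d : T -> T -> R) (x : T) (r : R) : set T :=
  [set y | d x y < r].

Definition mopen (T : Type) (d : T -> T -> R) (A : set T) : Prop :=
  forall x, A x -> exists2 r, 0 < r & mball d x r `<=` A.

Definition mcompact (T : Type) (d : T -> T -> R) (K : set T) : Prop :=
  forall (I : Type) (U : I -> set T), (forall i, mopen d (U i)) ->
    K `<=` \bigcup_i U i ->
    exists (n : nat) (f : nat -> I), K `<=` \bigcup_(j in [set j | (j < n)%N]) U (f j).

Definition mbounded (T : Type) (d : T -> T -> R) (A : set T) : Prop :=
  exists x r, A `<=` mball d x r.

Definition mconnected (T : Type) (d : T -> T -> R) (A : set T) : Prop :=
  forall U V, mopen d U -> mopen d V -> A `<=` U `|` V -> A `&` U `&` V = set0 ->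
    A `&` U = set0 \/ A `&` V = set0.

Definition bounded_domain (T : Type) (d : T -> T -> R) (O : set T) : Prop :=
  O !=set0 /\ mopen d O /\ mconnected d O /\ mbounded d O.

Definition isometric_embedding (S T : Type) (dS : S -> S -> R) (dT : T -> T -> R)
  (f : S -> T) : Prop := forall a b, dT (f a) (f b) = dS a b.

Definition uniformly_compact (Y : nat -> Type) (d : forall m, Y m -> Y m -> R)
  (K : forall m, set (Y m)) : Prop :=
  (exists D : R, forall m a b, K m a -> K m b -> d m a b <= D) /\
  (forall e, 0 < e -> exists N : nat, forall m, exists c : nat -> Y m,
      K m `<=` \bigcup_(j in [set j | (j < N)%N]) mball (d m) (c j) e).

Definition curve_length (T : Type) (d : T -> T -> R) (g : R -> T) (a b : R) : \bar R :=
  ereal_sup [set x | exists (n : nat) (t : nat -> R),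
    [/\ t 0%N = a, t n = b, (forall i, (i < n)%N -> t i <= t i.+1) &
        x = (\sum_(i < n) d (g (t i)) (g (t i.+1)))%:E]].

Definition arclength_param (T : Type) (d : T -> T -> R) (g : R -> T) (L : R) : Prop :=
  forall s t, 0 <= s -> s <= t -> t <= L -> curve_length d g s t = (t - s)%:E.

Definition PhiE (Phi : R -> R) (x : \bar R) : \bar R :=
  match x with EFin r => (Phi r)%:E | _ => +oo%E end.

Definition Phi_invE (Phi : R -> R) (t : \bar R) : \bar R :=
  ereal_sup [set x | exists s, [/\ 0 <= s, ((Phi s)%:E <= t)%E & x = s%:E]].

Definition N_function (Phi : R -> R) : Prop :=
  continuous Phi /\ (forall x, Phi (- x) = Phi x) /\
  (forall x y t, (0 <= t) && (t <= 1) -> Phi (t * x + (1 - t) * y) <= t * Phi x + (1 - t) * Phi y) /\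
  (forall x, 0 <= Phi x) /\ (forall x, Phi x = 0 <-> x = 0) /\
  ((fun x => Phi x / x) @ (0 : R)^' --> (0 : R)) /\
  ((fun x => Phi x / x) @ +oo --> +oo).

Definition Delta' (Phi : R -> R) : Prop :=
  exists C', 0 < C' /\ forall x y, Phi (x * y) <= C' * Phi x * Phi y.

Definition nabla2 (Phi : R -> R) : Prop :=
  exists C, 1 < C /\ forall x, Phi x <= (2 * C)^-1 * Phi (C * x).

End MetricDefs.

Section MeasureDefs.
Context {R : realType} {dd : measure_display} {X : measurableType dd}.

Definition borel_sets (dX : X -> X -> R) : set (set X) := <<s [set A | mopen dX A] >>.

Definition borel_fun (dX : X -> X -> R) (g : X -> \bar R) : Prop :=
  forall B : set (\bar R), measurable B -> borel_sets dX (g @^-1` B).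

Definition doubling (dX : X -> X -> R) (mu : {measure set X -> \bar R}) : Prop :=
  exists Cd : R, forall x r, 0 < r ->
    [/\ (0 < mu (mball dX x (2 * r)))%E,
        (mu (mball dX x (2 * r)) <= Cd%:E * mu (mball dX x r))%E &
        (mu (mball dX x (2 * r)) < +oo)%E].

Definition upper_gradient (dX : X -> X -> R) (O : set X) (u : X -> R) (g : X -> \bar R) : Prop :=
  borel_fun dX g /\ (forall x, (0 <= g x)%E) /\
  forall (L : R) (gam : R -> X), 0 <= L -> arclength_param dX gam L ->
    (forall t, (0 <= t) && (t <= L) -> O (gam t)) ->
    ((`|u (gam 0) - u (gam L)|)%:E <=
       \int[lebesgue_measure]_(t in [set t : R | ((0 <= t) && (t <= L))%R]) g (gam t))%E.

Definition avg (mu : {measure set X -> \bar R}) (B : set X) (f : X -> \bar R) : \bar R :=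
  ((fine (mu B))^-1)%:E * \int[mu]_(y in B) f y.

Definition local_Poincare (dX : X -> X -> R) (mu : {measure set X -> \bar R})
  (Phi : R -> R) (O : set X) : Prop :=
  exists CP lam : R, 0 < CP /\ 1 <= lam /\
  forall (u : X -> R) (g : X -> \bar R) (x : X) (r : R),
    mu.-integrable O (EFin \o u) -> upper_gradient dX O u g -> 0 < r ->
    mball dX x (lam * r) `<=` O ->
    let B := mball dX x r in
    let uB := fine (\int[mu]_(y in B) (u y)%:E) / fine (mu B) in
    (avg mu B (fun y => (`|u y - uB|)%:E) <=
      (CP * r)%:E * Phi_invE Phi (avg mu (mball dX x (lam * r)) (fun y => PhiE Phi (g y))))%E.

Definition lux_norm (mu : {measure set X -> \bar R}) (Phi : R -> R) (O : set X)
  (f : X -> R) : \bar R :=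
  ereal_inf [set x | exists k : R, [/\ 0 < k,
     (\int[mu]_(y in O) (Phi (f y / k))%:E <= 1)%E & x = k%:E]].

Definition in_LPhi (mu : {measure set X -> \bar R}) (Phi : R -> R) (O : set X)
  (f : X -> R) : Prop :=
  measurable_fun O f /\ (lux_norm mu Phi O f < +oo)%E.

Definition mmeasurable (Y : Type) (dY : Y -> Y -> R) (O : set X) (u : X -> Y) : Prop :=
  forall A, mopen dY A -> measurable (O `&` u @^-1` A).

Definition in_LPhiY (mu : {measure set X -> \bar R}) (Phi : R -> R) (O : set X)
  (Y : Type) (dY : Y -> Y -> R) (u : X -> Y) : Prop :=
  mmeasurable dY O u /\ exists y : Y, in_LPhi mu Phi O (fun x => dY y (u x)).

Definition hajlasz_gradient (dX : X -> X -> R) (mu : {measure set X -> \bar R})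
  (Phi : R -> R) (O : set X) (Y : Type) (dY : Y -> Y -> R) (u : X -> Y) (g : X -> R) : Prop :=
  (forall x, 0 <= g x) /\ in_LPhi mu Phi O g /\
  exists N, mu.-negligible N /\
    forall x x', O x -> O x' -> ~ N x -> ~ N x' ->
      dY (u x) (u x') <= dX x x' * (g x + g x').

Definition M1Phi (dX : X -> X -> R) (mu : {measure set X -> \bar R})
  (Phi : R -> R) (O : set X) (Y : Type) (dY : Y -> Y -> R) (u : X -> Y) : Prop :=
  in_LPhiY mu Phi O dY u /\ exists g, hajlasz_gradient dX mu Phi O dY u g.

Definition EH (dX : X -> X -> R) (mu : {measure set X -> \bar R})
  (Phi : R -> R) (O : set X) (Y : Type) (dY : Y -> Y -> R) (u : X -> Y) : \bar R :=
  ereal_inf [set x | exists g, hajlasz_gradient dX mu Phi O dY u g /\ x = lux_norm mu Phi O g].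

End MeasureDefs.

(* Main.v *)
(** In an Orlicz class, pieces of diameter at most [delta] give
    [d(u x, u x_i) <= delta (g x + g x_i)], so choosing in each piece a point
    where [Phi (g / k)] is at most about its average approximates [u] in norm, up to
    [O(delta)], by a map constant on the pieces, with values at distances from the
    base point bounded independently of [m].  A bounded set in a doubling space is
    totally bounded, so finitely many pieces suffice.  Along a subsequence the
    distances between all these countably many values (and the points of nets of
    the [K m]) converge, hence all the [Y m] embed in one complete space where the values
    themselves converge.  The limiting step maps form a Cauchy sequence with limit
    [v].  A Hajlasz gradient of [v] is an almost everywhere limit of iterated midpoints
    of gradients of the [u m]; such a limit exists without any reflexivity, by minimising
    the strictly convex bounded functional [f |-> \int exp (- f)]. *)

Require Import Defs.
From mathcomp Require Import all_boot all_order all_algebra.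
From mathcomp Require Import all_classical all_reals all_analysis.
From mathcomp Require Import measurable_realfun.
From mathcomp Require Import ring lra.
Import Order.TTheory GRing.Theory Num.Theory.
Import numFieldNormedType.Exports.
Local Open Scope classical_set_scope.
Local Open Scope ring_scope.

(** The targets differ from map to map, none is assumed separable, and the values of the maps lie in
    no compact set: only the [K m] are uniformly compact. Hence compactness is sought for bounded
    real sequences, the distances between labelled values. A space of bounded functions serves as
    common target since it is complete at once and isometry is tested on one well-chosen function.
    Norm bounds are handled in the form [modular f k <= 1]: convexity makes it additive in [f] and
    [k] together, Fatou's lemma closes it under almost everywhere limits, and no infimum has to be
    attained. The gradients are only bounded in norm and need not converge almost everywhere; their
    inequality is affine in the gradient and so survives midpoints. Norm errors decay like
    [4 ^ - j], so that measuring them against [2 ^ - j] still leaves a summable bound. *)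

Section RealSequences.
Context {R : realType}.

Lemma cvg_natP (a : nat -> R) (l : R) :
  a @ \oo --> l <-> forall e, 0 < e -> exists N, forall n, (N <= n)%N -> `|a n - l| < e.
Proof.
split => [/cvgrPdist_lt al e /al[N _ aN]|al].
  by exists N => n Nn; rewrite distrC; exact: aN.
apply/cvgrPdist_lt => e /al[N aN]; exists N => // n Nn.
by rewrite distrC; exact: aN.
Qed.

Lemma cvg0_natP (a : nat -> R) :
  a @ \oo --> (0 : R) <-> forall e, 0 < e -> exists N, forall n, (N <= n)%N -> `|a n| < e.
Proof.
split => [/cvg_natP al e /al[N aN]|al].
  by exists N => n /aN; rewrite subr0.
by apply/cvg_natP => e /al[N aN]; exists N => n /aN; rewrite subr0.
Qed.

Lemma real_cauchy (a : nat -> R) :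
  (forall e, 0 < e -> exists N, forall n m, (N <= n)%N -> (N <= m)%N -> `|a n - a m| < e) ->
  exists l, forall e, 0 < e -> exists N, forall n, (N <= n)%N -> `|a n - l| < e.
Proof.
move=> aC; have /cvg_ex[l /cvg_natP al] : cvg (a @ \oo); last by exists l.
apply/cauchy_cvgP/cauchyP => e e0; have [N aN] := aC e e0.
exists (a N); exists N => // n /= Nn.
exact: aN.
Qed.

End RealSequences.

(** * Bounded real functions with the supremum metric *)

Section BoundedFunctions.
Context {R : realType} {I : Type}.

Definition bfun := {f : I -> R | exists M, forall i, `|f i| <= M}.

(** The value [0] is adjoined to keep the set nonempty when [I] is empty. *)
Definition bdist (f g : bfun) : R :=
  sup [set r | r = 0 \/ exists i, r = `|sval f i - sval g i|].

Lemma bdist_ub (f g : bfun) i : `|sval f i - sval g i| <= bdist f g.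
Proof.
apply: ub_le_sup; last by right; exists i.
case: f g => f [M fM] [g [N gN]] /=; exists (M + N) => _ [->|[j ->]] /=.
  by rewrite addr_ge0 // (le_trans _ (fM i), le_trans _ (gN i)).
by rewrite (le_trans (ler_normB _ _)) // lerD.
Qed.

Lemma bdist_le (f g : bfun) M : 0 <= M ->
  (forall i, `|sval f i - sval g i| <= M) -> bdist f g <= M.
Proof.
move=> M0 fgM; apply: ge_sup; first by exists 0; left.
by move=> _ [->|[i ->]].
Qed.

Lemma bdist_ge0 (f g : bfun) : 0 <= bdist f g.
Proof.
apply: ub_le_sup; last by left.
case: f g => f [M fM] [g [N gN]] /=; exists (Num.max 0 (M + N)) => _ [->|[j ->]] /=.
  by rewrite le_max lexx.
by rewrite le_max; apply/orP; right; rewrite (le_trans (ler_normB _ _)) // lerD.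
Qed.

Lemma bdist_metric : is_metric bdist.
Proof.
split; first exact: bdist_ge0.
split.
  move=> f g; split => [fg0|<-].
    have E : sval f = sval g.
      apply/funext => i; apply/eqP.
      by rewrite -subr_eq0 -normr_le0 -fg0 bdist_ub.
    case: f g {fg0} E => f fM [g gM] /= E; subst g.
    by congr exist; exact: Prop_irrelevance.
  by apply/eqP; rewrite eq_le bdist_ge0 andbT bdist_le // => i; rewrite subrr normr0.
split.
  move=> f g; apply/eqP; rewrite eq_le; apply/andP; split;
    by apply: bdist_le (bdist_ge0 _ _) _ => i; rewrite distrC bdist_ub.
move=> f g h; apply: bdist_le => [|i]; first by rewrite addr_ge0 ?bdist_ge0.
by rewrite (le_trans (ler_distD (sval g i) _ _)) // lerD ?bdist_ub.
Qed.

Lemma bdist_complete : complete_metric bdist.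
Proof.
move=> u uC.
have uCi i : exists l, forall e, 0 < e ->
    exists N, forall n, (N <= n)%N -> `|sval (u n) i - l| < e.
  apply: real_cauchy => e /uC[N uN]; exists N => n m Nn Nm.
  exact: le_lt_trans (bdist_ub _ _ _) (uN _ _ Nn Nm).
have [l ul] := choice uCi.
have unif e : 0 < e -> exists N, forall n, (N <= n)%N ->
    forall i, `|sval (u n) i - l i| <= e.
  move=> /uC[N uN]; exists N => n Nn i; apply/ler_addgt0Pr => e' /(ul i)[N' uN'].
  have := uN' (maxn N N') (leq_maxr _ _).
  have := le_lt_trans (bdist_ub _ _ i) (uN _ _ Nn (leq_maxl N N')).
  move=> /ltW h1 /ltW h2; rewrite (le_trans (ler_distD (sval (u (maxn N N')) i) _ _)) //.
  exact: lerD.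
have lb : exists M, forall i, `|l i| <= M.
  have [N uN] := unif _ ltr01; case: (proj2_sig (u N)) => M uM.
  exists (M + 1) => i; rewrite -[l i](subKr (sval (u N) i)).
  by rewrite (le_trans (ler_normB _ _)) // lerD // uN.
exists (exist _ l lb); apply/cvg0_natP => e e0.
have [N uN] := unif _ (divr_gt0 e0 (ltr0n _ 2)); exists N => n Nn.
rewrite ger0_norm ?bdist_ge0 //; apply: (@le_lt_trans _ _ (e / 2)).
  by apply: bdist_le => [|i]; [rewrite divr_ge0 // ltW | exact: uN].
lra.
Qed.

End BoundedFunctions.

(** * Gluing metric spaces along marked points with converging distances *)

Section Gluing.
Set Implicit Arguments.
Unset Strict Implicit.
Context {R : realType}.

(** The McShane infimum runs over finitely many indices, [n] included, so it needs no lower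
    bound. *)
Fixpoint min_upto (s : nat -> R) (n : nat) : R :=
  if n is n'.+1 then Num.min (s n) (min_upto s n') else s 0%N.

Lemma min_upto_le s n k : (k <= n)%N -> min_upto s n <= s k.
Proof.
elim: n => [|n IH]; first by rewrite leqn0 => /eqP ->.
rewrite leq_eqVlt => /predU1P[->|kn] /=; first by rewrite ge_min lexx.
by rewrite ge_min IH ?orbT.
Qed.

Lemma le_min_upto s n a : (forall k, (k <= n)%N -> a <= s k) -> a <= min_upto s n.
Proof.
elim: n => [|n IH] an /=; first exact: an.
by rewrite le_min an //= IH // => k kn; apply: an; exact: leqW.
Qed.

Lemma min_upto_lip s t n (c : R) : (forall k, (k <= n)%N -> `|s k - t k| <= c) ->
  `|min_upto s n - min_upto t n| <= c.
Proof.
have half s' t' : (forall k, (k <= n)%N -> `|s' k - t' k| <= c) ->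
    min_upto s' n - c <= min_upto t' n.
  move=> st; apply: le_min_upto => k kn; rewrite lerBlDr.
  rewrite (le_trans (min_upto_le s' kn)) //.
  by have := le_trans (ler_norm _) (st k kn); rewrite lerBlDl.
move=> st; rewrite ler_distlC half //=.
rewrite -lerBlDr half // => k kn; rewrite distrC; exact: st.
Qed.

Context (Y : nat -> Type) (d : forall m, Y m -> Y m -> R) (p : forall m, nat -> Y m)
  (rho : nat -> nat -> R) (eps : nat -> R).
Arguments d {m}.
Hypothesis dmet : forall m, is_metric (@d m).
Hypothesis eps_noninc : forall m n, (m <= n)%N -> eps n <= eps m.
Hypothesis eps_ge0 : forall m, 0 <= eps m.
Hypothesis rho_xx : forall k, rho k k = 0.
Hypothesis rho_tri : forall k l j, rho k j <= rho k l + rho l j.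
Hypothesis p_rho : forall m k l, (k <= m)%N -> (l <= m)%N ->
  `|d (p m k) (p m l) - rho k l| <= eps m.

(* The glued space consists of bounded functions on the set of compatible families; the
   evaluation of a family at [x] is the image of [x], so that distances are read off as
   suprema of [|F m x - F n y|]. *)
Definition compatible (F : forall m, Y m -> R) :=
  (forall m x y, `|F m x - F m y| <= d x y) /\
  forall k m n, (k <= m)%N -> (m <= n)%N ->
    `|F m (p m k) - F n (p n k)| <= 2 * eps m.

(* McShane extension: a 1-Lipschitz [f] on one [Y m] is carried through the limit distances
   [rho] of the marked points to every other [Y n], which makes the embeddings isometric. *)
Definition transported m (f : Y m -> R) (k : nat) : R :=
  min_upto (fun l => f (p m l) + rho l k) m.

(** On its own space [f] is kept unchanged, whence the transport along [m = n]: the McShane formula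
    sees only marked points and would lose [f] elsewhere. *)
Definition extend_fun m (f : Y m -> R) : forall n, Y n -> R := fun n =>
  match pselect (m = n) with
  | left e => eq_rect m (fun n => Y n -> R) f n e
  | right _ => fun x => min_upto (fun k => transported f k + d (p n k) x) n
  end.
Arguments extend_fun {m} f n _.

Lemma extend_fun_id m (f : Y m -> R) : extend_fun f m = f.
Proof. by rewrite /extend_fun; case: pselect => // e; rewrite (Prop_irrelevance e erefl). Qed.

Lemma extend_fun_ne m (f : Y m -> R) n : m <> n ->
  extend_fun f n = fun x => min_upto (fun k => transported f k + d (p n k) x) n.
Proof. by rewrite /extend_fun; case: pselect. Qed.

Lemma dist_xx m (x : Y m) : d x x = 0.
Proof. by have [_ [h _]] := dmet m; apply/h. Qed.

Lemma extend_fun_lip m (f : Y m -> R) : (forall x y, `|f x - f y| <= d x y) ->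
  forall n x y, `|extend_fun f n x - extend_fun f n y| <= d x y.
Proof.
move=> flip n x y; have [e|mn] := pselect (m = n).
  by subst n; rewrite extend_fun_id.
rewrite extend_fun_ne //; apply: min_upto_lip => k kn.
have [_ [_ [ds dt]]] := dmet n; rewrite ler_distl.
have := dt (p n k) x y; have := dt (p n k) y x; rewrite (ds y x).
by move=> h1 h2; apply/andP; split; lra.
Qed.

(** The lower bound is the Lipschitz condition with [d] replaced by [rho] at the cost of [eps m];
    the upper one is the term [l = k] of the minimum. *)
Lemma transported_near m (f : Y m -> R) : (forall x y, `|f x - f y| <= d x y) ->
  forall k, (k <= m)%N -> f (p m k) - eps m <= transported f k <= f (p m k).
Proof.
move=> flip k km; apply/andP; split.
  apply: le_min_upto => l lm.
  have := p_rho lm km; have := flip (p m l) (p m k).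
  by rewrite !ler_distl => /andP[h1 h2] /andP[h3 h4]; lra.
by apply: le_trans (min_upto_le _ km) _; rewrite rho_xx addr0.
Qed.

Lemma transported_lip m (f : Y m -> R) k l : transported f k <= transported f l + rho l k.
Proof.
rewrite -lerBlDr; apply: le_min_upto => j jm; rewrite lerBlDr.
apply: le_trans (min_upto_le _ jm) _ => /=.
by have := rho_tri j l k; lra.
Qed.

Lemma extend_fun_near m (f : Y m -> R) n k : m <> n -> (k <= n)%N ->
  transported f k - eps n <= extend_fun f n (p n k) <= transported f k.
Proof.
move=> mn kn; rewrite extend_fun_ne //; apply/andP; split.
  apply: le_min_upto => l ln.
  have := p_rho ln kn; have := transported_lip f k l.
  by rewrite !ler_distl => h1 /andP[h2 h3]; lra.
by apply: le_trans (min_upto_le _ kn) _; rewrite dist_xx addr0.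
Qed.

Lemma extend_fun_compatible m (f : Y m -> R) : (forall x y, `|f x - f y| <= d x y) ->
  compatible (extend_fun f).
Proof.
move=> flip; split; first exact: extend_fun_lip.
move=> k a b ka ab; have kb := leq_trans ka ab.
have eab := eps_noninc ab; have eb := eps_ge0 b.
(* The value lies above [transported f k] on the space of origin and below it on the others, always
   within [eps n]; two spaces thus differ by at most [eps a + eps b <= 2 * eps a]. *)
have near n : (k <= n)%N ->
  transported f k - eps n <= extend_fun f n (p n k) <= transported f k + (m == n)%:R * eps n.
  move=> kn; have [e|mn] := pselect (m = n).
    subst n; rewrite extend_fun_id eqxx mul1r.
    have := transported_near flip kn; have := eps_ge0 m.
    by move=> h1 /andP[h2 h3]; apply/andP; split; lra.
  by move/eqP/negbTE: (mn) => ->; rewrite mul0r addr0; exact: extend_fun_near.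
have [/andP[h1 h2] /andP[h3 h4]] := (near a ka, near b kb); rewrite ler_distl.
move: h2 h4.
have [ea|na] := eqVneq m a; have [eb'|nb] := eqVneq m b;
  rewrite ?mul0r ?mul1r ?addr0 => h2 h4; apply/andP; split; try lra.
Qed.

(** Evaluation at [x] alone is unbounded, as constants may be added to a compatible family;
    subtracting the value at one base point repairs this, as in the Kuratowski embedding. *)
Lemma compatible_bounded m (x : Y m) : exists M, forall F : {F | compatible F},
  `|sval F m x - sval F 0%N (p 0%N 0%N)| <= M.
Proof.
exists (d x (p m 0%N) + 2 * eps 0%N) => -[F [Flip Fp]] /=.
have := Flip m x (p m 0%N); have := Fp 0%N 0%N m (leqnn _) (leq0n _).
by rewrite !ler_distl => /andP[h1 h2] /andP[h3 h4]; apply/andP; split; lra.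
Qed.

Lemma glued_space : exists (Z : Type) (dZ : Z -> Z -> R) (phi : forall m, Y m -> Z),
  [/\ is_metric dZ, complete_metric dZ, forall m, isometric_embedding (@d m) dZ (phi m) &
      forall k m n, (k <= m)%N -> (m <= n)%N ->
        dZ (phi m (p m k)) (phi n (p n k)) <= 2 * eps m].
Proof.
pose I := {F : forall m, Y m -> R | compatible F}.
pose phi m (x : Y m) : @bfun R I :=
  exist _ (fun F : I => sval F m x - sval F 0%N (p 0%N 0%N)) (compatible_bounded x).
have sub0 (a b c : R) : (a - c) - (b - c) = a - b by lra.
exists (@bfun R I), (@bdist R I), phi; split.
- exact: bdist_metric.
- exact: bdist_complete.
- move=> m x y; have [d0 [dE [ds dt]]] := dmet m.
  apply/eqP; rewrite eq_le; apply/andP; split.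
    by apply: bdist_le => // -[F [Flip Fp]] /=; rewrite sub0.
  (* The test function for isometry: its extension already separates the images of [x] and [y] by
     [d x y]. *)
  pose f := fun z : Y m => d z y.
  have flip a b : `|f a - f b| <= d a b.
    have := dt a b y; have := dt b a y; rewrite ler_distl /f (ds b a).
    by move=> h1 h2; apply/andP; split; lra.
  have := bdist_ub (phi m x) (phi m y) (exist _ _ (extend_fun_compatible flip)).
  by rewrite /= sub0 extend_fun_id /f dist_xx subr0 ger0_norm.
- move=> k m n km mn; apply: bdist_le; first by rewrite mulr_ge0.
  by move=> [F [Flip Fp]] /=; rewrite sub0; exact: Fp.
Qed.

End Gluing.

(** * Extraction of a subsequence for many bounded real sequences *)

Section DiagonalSubsequence.
Set Implicit Arguments.
Unset Strict Implicit.
Context {R : realType}.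

(** An ultrafilter containing all tails gives every bounded sequence its limit at once, in place of
    nested subsequences. For each [n] the finitely many conditions from [S n] hold together on a set
    of the ultrafilter, which contains arbitrarily large indices. *)
Lemma diagonal_extraction (T : eqType) (S : nat -> seq T) (a : nat -> T -> R) (e : nat -> R) :
  (forall n, 0 < e n) -> (forall t, exists B, forall m, `|a m t| <= B) ->
  exists (sigma : nat -> nat) (l : T -> R), (forall n, (sigma n < sigma n.+1)%N) /\
    forall n t, t \in S n -> `|a (sigma n) t - l t| < e n.
Proof.
move=> e0 aB.
have [U [UU Usub]] := @ultraFilterLemma nat \oo _.
have UF : ProperFilter U by exact: ultra_proper.
have /choice[l al] t : exists l : R, forall e, 0 < e -> U [set m | `|a m t - l| < e].
  have [B atB] := aB t.
  have UB : U [set m | a m t \in `[- B, B]].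
    apply: (filterS _ (@filterT _ U _)) => m _ /=.
    by rewrite in_itv /= -ler_norml.
  have [l [_ al]] := @segment_compact R (- B) B (fmap (a ^~ t) U) _ UB.
  exists l => e' e'0.
  have [//|nU] := in_ultra_setVsetC [set m | `|a m t - l| < e'] UU.
  have nU' : U [set m | ~ ball l e' (a m t)].
    by apply: (filterS _ nU) => m /=; rewrite -ball_normE /= distrC.
  by have [x []] := al (~` ball l e') _ nU' (nbhsx_ballx l e' e'0).
have next n N : exists m, (N < m)%N /\ forall t, t \in S n -> `|a m t - l t| < e n.
  have /filter_ex[m [Nm am]] : U ([set m | (N < m)%N] `&`
      [set m | forall t, t \in S n -> `|a m t - l t| < e n]).
    apply: filterI; first by apply: Usub; exists N.+1.
    elim: (S n) => [|t s IH]; first by apply: (filterS _ (@filterT _ U _)).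
    apply: (filterS _ (filterI IH (al t (e n) (e0 n)))) => m [ms mt] t'.
    by rewrite inE => /predU1P[->//|]; exact: ms.
  by exists m.
have [nx nxP] := choice (fun nN : nat * nat => next nN.1 nN.2).
pose fix sigma n := if n is n'.+1 then nx (n, sigma n') else nx (0%N, 0%N).
exists sigma, l; split => [n|[|n]].
- by have [] := nxP (n.+1, sigma n).
- by have [] := nxP (0%N, 0%N).
- by have [] := nxP (n.+1, sigma n).
Qed.

End DiagonalSubsequence.

Section HalfPowers.
Set Implicit Arguments.
Unset Strict Implicit.
Context {R : realType}.

Lemma half_pow_gt0 n : 0 < (2^-1 : R) ^+ n.
Proof. by rewrite exprn_gt0 // invr_gt0. Qed.

Lemma half_pow_le m n : (m <= n)%N -> (2^-1 : R) ^+ n <= 2^-1 ^+ m.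
Proof. by move=> mn; apply: ler_wiXn2l => //; rewrite invf_le1 // ler1n. Qed.

Lemma half_pow_lt (e : R) : 0 < e -> exists N, forall n, (N <= n)%N -> (2^-1 : R) ^+ n < e.
Proof.
move=> e0; have h : `|2^-1 : R| < 1 by rewrite ger0_norm // invf_lt1 // ltr1n.
have /cvg0_natP/(_ e e0)[N hN] := cvg_expr h.
by exists N => n /hN; rewrite ger0_norm // ltW // half_pow_gt0.
Qed.

Lemma le_half_pow (x y c : R) N :
  (forall n, (N <= n)%N -> x <= y + c * 2^-1 ^+ n) -> x <= y.
Proof.
move=> h; apply/ler_addgt0Pr => e e0.
have c0 : 0 < `|c| + 1 by rewrite ltr_wpDl.
have [M hM] := half_pow_lt (divr_gt0 e0 c0).
apply: (le_trans (h (maxn N M) (leq_maxl _ _))); rewrite lerD2l.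
have := hM _ (leq_maxr N M); rewrite ltr_pdivlMr // => /ltW; apply: le_trans.
rewrite mulrC ler_wpM2l //.
by rewrite (le_trans (ler_norm _)) // lerDl.
Qed.

End HalfPowers.

(** * A common complete space for a subsequence *)

Section CommonEmbedding.
Set Implicit Arguments.
Unset Strict Implicit.
Context {R : realType} (Y : nat -> Type) (d : forall m, Y m -> Y m -> R).
Arguments d {m}.
Context (T : countType) (t0 : T) (P : forall m, T -> Y m).

Lemma common_embedding : (forall m, is_metric (@d m)) ->
  (forall s t, exists B, forall m, d (P m s) (P m t) <= B) ->
  exists sigma : nat -> nat, (forall n, (sigma n < sigma n.+1)%N) /\
  exists (Z : Type) (dZ : Z -> Z -> R) (phi : forall n, Y (sigma n) -> Z) (z : T -> Z),
    [/\ is_metric dZ, complete_metric dZ,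
        forall n, isometric_embedding (@d (sigma n)) dZ (phi n) &
        forall t e, 0 < e -> exists N, forall n, (N <= n)%N ->
          dZ (phi n (P (sigma n) t)) (z t) < e].
Proof.
(* [D] enumerates [T], with [t0] at numbers that code nothing. [S n] holds all pairs among the first
   [n + 1] points, as the gluing asks at stage [n]. *)
move=> dmet Pbd; pose D k : T := odflt t0 (unpickle k).
pose S n := [seq (D kl.1, D kl.2) | kl <- allpairs pair (iota 0 n.+1) (iota 0 n.+1)].
have SP n k l : (k <= n)%N -> (l <= n)%N -> (D k, D l) \in S n.
  move=> kn ln; apply/mapP; exists (k, l) => //.
  by apply/allpairsP; exists (k, l); rewrite !mem_iota.
have [|st|sigma [L [sS aL]]] := @diagonal_extraction R (T * T)%type S
    (fun m st => d (P m st.1) (P m st.2)) (fun n => 2^-1 ^+ n).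
- by move=> n; exact: half_pow_gt0.
- have [B PB] := Pbd st.1 st.2; exists B => m; rewrite ger0_norm //.
  by have [? _] := dmet m.
exists sigma; split => //.
pose p n k : Y (sigma n) := P (sigma n) (D k).
pose rho k l := L (D k, D l).
have prho m k l : (k <= m)%N -> (l <= m)%N ->
    `|d (p m k) (p m l) - rho k l| <= 2^-1 ^+ m.
  by move=> km lm; apply: ltW; exact: aL (SP _ _ _ km lm).
have rho_xx k : rho k k = 0.
  apply/eqP; rewrite -normr_le0; apply: (@le_half_pow _ _ _ 1 k) => n kn.
  have := prho n k k kn kn; have [_ [dE _]] := dmet (sigma n).
  by rewrite (_ : d _ _ = 0) ?sub0r ?normrN ?add0r ?mul1r //; exact/dE.
have rho_tri k l j : rho k j <= rho k l + rho l j.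
  apply: (@le_half_pow _ _ _ 3 (maxn k (maxn l j))) => n; rewrite !geq_max.
  move=> /andP[kn /andP[ln jn]]; have [_ [_ [_ dt]]] := dmet (sigma n).
  have := dt (p n k) (p n l) (p n j).
  move: (prho n k j kn jn) (prho n k l kn ln) (prho n l j ln jn).
  by rewrite !ler_distl => /andP[h1 h2] /andP[h3 h4] /andP[h5 h6] h7; lra.
have [Z [dZ [phi [Zm Zc Zi Zp]]]] := @glued_space R (fun n => Y (sigma n))
  (fun n => @d (sigma n)) p rho (fun n => 2^-1 ^+ n) (fun n => dmet (sigma n))
  (fun m n => @half_pow_le R m n) (fun n => ltW (half_pow_gt0 n)) rho_xx rho_tri prho.
exists Z, dZ, phi.
suff /choice[z zP] t : exists z, forall e, 0 < e -> exists N, forall n, (N <= n)%N ->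
    dZ (phi n (P (sigma n) t)) z < e by exists z.
have Dt : D (pickle t) = t by rewrite /D pickleK.
have [|z /cvg0_natP zP] := Zc (fun n => phi n (P (sigma n) t)).
  move=> e e0; have [N hN] := half_pow_lt (divr_gt0 e0 (ltr0n _ 2)).
  (* From stage [pickle t] on, [t] is one of the marked points, and the gluing puts its copies at
     stages [n <= m] within [2 * 2^-1 ^+ n]. *)
  have key n m : (maxn N (pickle t) <= n)%N -> (n <= m)%N ->
      dZ (phi n (P (sigma n) t)) (phi m (P (sigma m) t)) < e.
    rewrite geq_max => /andP[Nn tn] nm.
    have := Zp _ _ _ tn nm; rewrite /p Dt; have := hN _ Nn; lra.
  exists (maxn N (pickle t)) => n m Nn Nm; have [nm|/ltnW mn] := leqP n m.
    exact: key.
  by rewrite Zm.2.2.1; exact: key.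
exists z => e /zP[N hN]; exists N => n /hN; apply: le_lt_trans; exact: ler_norm.
Qed.

End CommonEmbedding.

(** * Compactness from completeness and total boundedness *)

Section Compactness.
Set Implicit Arguments.
Unset Strict Implicit.
Context {R : realType} {Z : Type} (dZ : Z -> Z -> R).

Definition totally_bounded (A : set Z) := forall e, 0 < e ->
  exists (N : nat) (c : nat -> Z), A `<=` \bigcup_(j in [set j | (j < N)%N]) mball dZ (c j) e.

(* An index [f : nat -> I] is required even for an empty cover, as in [mcompact]; hence the
   inhabitants of [I] asked for below. *)
Definition finitely_covered (I : Type) (U : I -> set Z) (A : set Z) :=
  exists (n : nat) (f : nat -> I), A `<=` \bigcup_(j in [set j | (j < n)%N]) U (f j).

Lemma finitely_coveredU I (U : I -> set Z) A B :
  finitely_covered U A -> finitely_covered U B -> finitely_covered U (A `|` B).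
Proof.
move=> [n [f Af]] [m [g Bg]]; exists (n + m)%N, (fun j => if (j < n)%N then f j else g (j - n)%N).
move=> z [/Af[j /= jn Uz]|/Bg[j /= jm Uz]].
  by exists j; rewrite /= ?jn // ltn_addr.
by exists (n + j)%N; rewrite /= ?ltn_add2l // ltnNge leq_addr /= addKn.
Qed.

Lemma finitely_covered_bigcup I (i0 : I) (U : I -> set Z) A (B : nat -> set Z) N :
  A `<=` \bigcup_(j in [set j | (j < N)%N]) B j ->
  (forall j, (j < N)%N -> finitely_covered U (A `&` B j)) -> finitely_covered U A.
Proof.
move=> AB h; suff [n [f ABf]] : finitely_covered U
    (A `&` \bigcup_(j in [set j | (j < N)%N]) B j).
  by exists n, f => z Az; apply: ABf; split => //; exact: AB.
elim: N {AB} h => [|N IH] h.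
  by exists 0%N, (fun=> i0) => z [_ [j]].
have [||n [f hf]] := @finitely_coveredU I U
    (A `&` \bigcup_(j in [set j | (j < N)%N]) B j) (A `&` B N).
- by apply: IH => j jN; apply: h; exact: ltnW.
- exact: h.
- exists n, f => z [Az [j /=]]; rewrite ltnS leq_eqVlt => /predU1P[->|jN] Bz.
    by apply: hf; right.
  by apply: hf; left; split => //; exists j.
Qed.

Lemma totally_bounded_compact (A : set Z) : is_metric dZ -> complete_metric dZ ->
  A !=set0 -> totally_bounded A -> exists2 K, mcompact dZ K & A `<=` K.
Proof.
move=> [d0 [dE [ds dt]]] dC [a0 Aa0] Atb.
pose K := [set z | forall e, 0 < e -> exists2 a, A a & dZ a z < e].
exists K; last by move=> a Aa e e0; exists a => //; rewrite (_ : dZ a a = 0) //; exact/dE.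
move=> I U Uop KU.
have Ka0 : K a0 by move=> e e0; exists a0 => //; rewrite (_ : dZ a0 a0 = 0) //; exact/dE.
have [i0 _ _] := KU _ Ka0.
apply: contrapT => badK.
have Ktb e : 0 < e -> exists (N : nat) (c : nat -> Z),
    K `<=` \bigcup_(j in [set j | (j < N)%N]) mball dZ (c j) e.
  move=> e0; have e20 := divr_gt0 e0 (ltr0n _ 2); have [N [c Ac]] := Atb _ e20.
  exists N, c => z /(_ _ e20)[a /Ac[j /= jN ja] az]; exists j => //.
  by rewrite /mball /= in ja *; have := dt (c j) a z; lra.
(* If all intersections with small balls had finite subcovers, so would the set, by a finite net.
   The premises stand under the existential so that [choice] applies to every set; iterating gives
   nested uncovered sets shrinking to a point of [K]. *)
have split_bad (Bn : set Z * nat) : exists c, Bn.1 `<=` K -> ~ finitely_covered U Bn.1 ->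
    ~ finitely_covered U (Bn.1 `&` mball dZ c (2^-1 ^+ Bn.2)).
  case: Bn => B n /=; apply: contrapT => /forallNP h.
  have {}h c : [/\ B `<=` K, ~ finitely_covered U B &
      finitely_covered U (B `&` mball dZ c (2^-1 ^+ n))].
    by have /not_implyP[BK /not_implyP[nB /contrapT]] := h c; split.
  have [BK nB _] := h a0; apply: nB.
  have [N [c Kc]] := Ktb _ (half_pow_gt0 n).
  apply: (@finitely_covered_bigcup _ i0 U B (fun j => mball dZ (c j) (2^-1 ^+ n)) N).
    by move=> z /BK/Kc.
  by move=> j _; have [] := h (c j).
have [c cP] := choice split_bad.
pose B := fix B n := if n is n'.+1 then B n' `&` mball dZ (c (B n', n')) (2^-1 ^+ n') else K.
have BP n : B n `<=` K /\ ~ finitely_covered U (B n).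
  elim: n => [|n [BK nB]]; first by split.
  split; last by apply: (cP (B n, n)).
  by move=> z [/BK].
have /choice[x xB] n : exists x, B n x.
  apply: contrapT => /forallNP nB; apply: (BP n).2.
  by exists 0%N, (fun=> i0) => z /nB.
have Bsub n m : (n <= m)%N -> B m `<=` B n.
  move=> nm; rewrite -(subnK nm); elim: (m - n)%N => [|k IH] //.
  by move=> z [/IH].
have Bd n y z : B n.+1 y -> B n.+1 z -> dZ y z <= 2 * 2^-1 ^+ n.
  rewrite /= /mball /= => -[_ h1] [_ h2].
  by have := dt y (c (B n, n)) z; rewrite (ds y (c _)); lra.
have [|l /cvg0_natP xl] := dC x.
  move=> e e0; have [N hN] := half_pow_lt (divr_gt0 e0 (ltr0n _ 2)).
  exists N.+1 => n m Nn Nm; have := hN N (leqnn _).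
  by have := Bd _ _ _ (Bsub _ _ Nn _ (xB n)) (Bsub _ _ Nm _ (xB m)); lra.
have Kl : K l.
  move=> e e0; have e20 := divr_gt0 e0 (ltr0n _ 2); have [N hN] := xl _ e20.
  have [a Aa ax] := (BP N).1 _ (xB N) _ e20; exists a => //.
  have := hN N (leqnn _); rewrite ger0_norm // => h.
  by have := dt a (x N) l; lra.
have [i _ Ul] := KU _ Kl; have [r r0 rU] := Uop i l Ul.
have r40 := divr_gt0 r0 (ltr0n _ 4).
have [N1 h1] := half_pow_lt r40; have [N2 h2] := xl _ r40.
(* [B N.+1] lies in a ball of radius [2^-1 ^+ N < r / 4], so all its points are within
   [2 * (r / 4) + r / 4 < r] of [l]: a single [U i] covers it. *)
pose N := maxn N1 N2; apply: (BP N.+1).2; exists 1%N, (fun=> i) => z Bz; exists 0%N => //.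
apply: rU; rewrite /mball /=.
have := h1 N (leq_maxl _ _); have := h2 N.+1 (leqW (leq_maxr _ _)).
rewrite ger0_norm // => h3 h4; have := Bd _ _ _ Bz (xB N.+1).
have := dt l (x N.+1) z; rewrite (ds l (x _)) (ds (x _) z); lra.
Qed.

End Compactness.

(** * Convexity inequalities for N-functions *)

Section NFunctions.
Set Implicit Arguments.
Unset Strict Implicit.
Context {R : realType} (Phi : R -> R) (NPhi : N_function Phi).

Lemma Nfun_ge0 x : 0 <= Phi x.
Proof. by case: NPhi => _ [_ [_ [h _]]]. Qed.

Lemma Nfun_0 : Phi 0 = 0.
Proof. by case: NPhi => _ [_ [_ [_ [h _]]]]; apply/h. Qed.

Lemma Nfun_gt0 x : x != 0 -> 0 < Phi x.
Proof.
case: NPhi => _ [_ [_ [_ [h _]]]] x0; rewrite lt_neqAle Nfun_ge0 andbT eq_sym.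
by apply: contra_neq x0 => /h.
Qed.

Lemma Nfun_abs x : Phi `|x| = Phi x.
Proof. by case: NPhi => _ [h _]; case: (ger0P x) => // _; rewrite h. Qed.

Lemma Nfun_convex x y t : 0 <= t -> t <= 1 ->
  Phi (t * x + (1 - t) * y) <= t * Phi x + (1 - t) * Phi y.
Proof. by case: NPhi => _ [_ [h _]] t0 t1; apply: h; rewrite t0. Qed.

Lemma Nfun_scale c x : 0 <= c -> c <= 1 -> Phi (c * x) <= c * Phi x.
Proof.
by move=> c0 c1; have := Nfun_convex x 0 c0 c1; rewrite Nfun_0 !mulr0 !addr0.
Qed.

Lemma Nfun_mono x y : `|x| <= `|y| -> Phi x <= Phi y.
Proof.
have [->|y0] := eqVneq y 0; first by rewrite normr0 normr_le0 => /eqP ->.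
have ny0 : 0 < `|y| by rewrite normr_gt0.
move=> xy; rewrite -(Nfun_abs x) -(Nfun_abs y) -[`|x|](divfK (lt0r_neq0 ny0)).
have c1 : `|x| / `|y| <= 1 by rewrite ler_pdivrMr // mul1r.
have c0 : 0 <= `|x| / `|y| by rewrite divr_ge0.
by rewrite (le_trans (Nfun_scale _ c0 c1)) // ler_piMl // Nfun_ge0.
Qed.

Lemma Nfun_div_mono x y k : 0 < k -> `|x| <= `|y| -> Phi (x / k) <= Phi (y / k).
Proof.
move=> k0 xy; apply: Nfun_mono; rewrite !normrM ler_wpM2r // normr_ge0.
Qed.

(** The left argument is a convex combination of [x / a] and [y / b]; integrated, this is the
    triangle inequality of the Luxemburg norm. *)
Lemma Nfun_divD x y a b : 0 < a -> 0 < b ->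
  Phi ((x + y) / (a + b)) <= a / (a + b) * Phi (x / a) + b / (a + b) * Phi (y / b).
Proof.
move=> a0 b0; have ab0 : 0 < a + b by rewrite addr_gt0.
have -> : b / (a + b) = 1 - a / (a + b) by field; rewrite ?lt0r_neq0.
have -> : (x + y) / (a + b) = a / (a + b) * (x / a) + (1 - a / (a + b)) * (y / b).
  by field; rewrite !lt0r_neq0.
apply: Nfun_convex; first by rewrite divr_ge0 // ltW.
by rewrite ler_pdivrMr // mul1r lerDl ltW.
Qed.

(** Convexity compares [x] with the point [1] on the segment from [0]. The bound recovers sizes from
    values of [Phi] where an inverse would otherwise be called for. *)
Lemma Nfun_linear x : 1 <= `|x| -> `|x| * Phi 1 <= Phi x.
Proof.
move=> x1; have x0 : 0 < `|x| by rewrite (lt_le_trans ltr01).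
rewrite -(Nfun_abs x) mulrC -ler_pdivlMr // mulrC.
have := @Nfun_scale `|x|^-1 `|x|; rewrite mulVf ?lt0r_neq0 //; apply.
  by rewrite invr_ge0 ltW.
by rewrite invf_le1.
Qed.

Lemma Nfun_continuous : continuous Phi.
Proof. by case: NPhi. Qed.

Lemma Nfun_measurable : measurable_fun setT Phi.
Proof. exact: continuous_measurable_fun Nfun_continuous. Qed.

End NFunctions.

(** * Lower limits and Fatou's lemma *)

Section LimInf.
Set Implicit Arguments.
Unset Strict Implicit.
Context {R : realType} {dd : measure_display} {X : measurableType dd}
  (mu : {measure set X -> \bar R}) (O : set X) (F : nat -> X -> \bar R).
Hypothesis mO : measurable O.
Hypothesis F0 : forall n x, O x -> (0 <= F n x)%E.
Hypothesis mF : forall n, measurable_fun O (F n).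

Lemma limn_einf_ge (u : nat -> \bar R) c N : (forall n, (N <= n)%N -> (c <= u n)%E) ->
  (c <= limn_einf u)%E.
Proof.
move=> uc; rewrite limn_einf_lim; apply: lime_ge; first exact: is_cvg_einfs.
by exists N => // n /= Nn; apply: le_ereal_inf_tmp => _ [m /= nm <-]; apply: uc;
  exact: leq_trans nm.
Qed.

Lemma limn_einf_le (u : nat -> \bar R) c : (forall n, (u n <= c)%E) -> (limn_einf u <= c)%E.
Proof.
move=> uc; rewrite limn_einf_lim; apply: lime_le; first exact: is_cvg_einfs.
by apply: nearW => n; apply: ge_ereal_inf; exists (u n) => //; exists n => /=.
Qed.

Lemma measurable_limn_einf : measurable_fun O (fun x => limn_einf (F ^~ x)).
Proof.
have -> : (fun x => limn_einf (F ^~ x)) =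
    -%E \o (fun x => limn_esup ((fun n y => - F n y)%E ^~ x)).
  by apply/funext => x /=; rewrite -limn_einfN; congr limn_einf; apply/funext => n /=;
    rewrite oppeK.
apply: measurableT_comp => //; apply: measurable_fun_limn_esup => n.
by apply: measurableT_comp.
Qed.

Lemma fatou_le c : (forall n, (\int[mu]_(x in O) F n x <= c)%E) ->
  (\int[mu]_(x in O) limn_einf (F ^~ x) <= c)%E.
Proof. by move=> Fc; apply: le_trans (fatou mu mO mF F0) _; exact: limn_einf_le. Qed.

End LimInf.

(** * Calculus of the modular *)

Section Modular.
Set Implicit Arguments.
Unset Strict Implicit.
Context {R : realType} {dd : measure_display} {X : measurableType dd}
  (mu : {measure set X -> \bar R}) (Phi : R -> R) (O : set X).
Hypothesis NPhi : N_function Phi.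
Hypothesis mO : measurable O.
Implicit Types f g : X -> R.

(** [modular f k <= 1] stands for a norm bound by [k]; [modular_lux] and [lux_modular] translate
    between the two. *)
Definition modular f k : \bar R := (\int[mu]_(x in O) (Phi (f x / k))%:E)%E.

Lemma measurable_Nfun f k : measurable_fun O f -> measurable_fun O (fun x => Phi (f x / k)).
Proof.
move=> mf; apply: (measurableT_comp (Nfun_measurable NPhi)).
by apply: measurable_funM => //; exact: measurable_cst.
Qed.

Lemma measurable_Nfun_EFin f k : measurable_fun O f ->
  measurable_fun O (fun x => (Phi (f x / k))%:E).
Proof. by move=> mf; apply/measurable_EFinP; exact: measurable_Nfun. Qed.

Lemma Nfun_EFin_ge0 f k x : (0 <= (Phi (f x / k))%:E)%E.
Proof. by rewrite lee_fin Nfun_ge0. Qed.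

Lemma modular_ae_le f g k : 0 < k -> measurable_fun O f -> measurable_fun O g ->
  {ae mu, forall x, O x -> `|f x| <= `|g x|} -> (modular f k <= modular g k)%E.
Proof.
move=> k0 mf mg fg; apply: ae_ge0_le_integral => //.
- by move=> x _; exact: Nfun_EFin_ge0.
- exact: measurable_Nfun_EFin.
- by move=> x _; exact: Nfun_EFin_ge0.
- exact: measurable_Nfun_EFin.
by apply: filterS fg => x fgx Ox; rewrite lee_fin Nfun_div_mono // fgx.
Qed.

Lemma modular_le_scale f k k' : 0 < k -> k <= k' -> measurable_fun O f ->
  (modular f k' <= modular f k)%E.
Proof.
move=> k0 kk' mf; apply: ge0_le_integral => //.
- by move=> x _; exact: Nfun_EFin_ge0.
- exact: measurable_Nfun_EFin.
- exact: measurable_Nfun_EFin.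
move=> x _; rewrite lee_fin; apply: Nfun_mono => //; rewrite !normrM ler_wpM2l //.
have k'0 := lt_le_trans k0 kk'.
by rewrite !gtr0_norm ?invr_gt0 // lef_pV2.
Qed.

Lemma modularD_le1 f g a b : 0 < a -> 0 < b ->
  measurable_fun O f -> measurable_fun O g ->
  (modular f a <= 1)%E -> (modular g b <= 1)%E -> (modular (f \+ g)%R (a + b) <= 1)%E.
Proof.
move=> a0 b0 mf mg fa gb; have ab0 : 0 < a + b by rewrite addr_gt0.
have ca : 0 <= a / (a + b) by rewrite divr_ge0 ?ltW.
have cb : 0 <= b / (a + b) by rewrite divr_ge0 ?ltW.
apply: (@le_trans _ _ (\int[mu]_(x in O)
   ((a / (a + b))%:E * (Phi (f x / a))%:E + (b / (a + b))%:E * (Phi (g x / b))%:E)))%E.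
  apply: ge0_le_integral => //.
  - by move=> x _; rewrite lee_fin Nfun_ge0.
  - by apply: measurable_Nfun_EFin; exact: measurable_funD.
  - by apply: emeasurable_funD; apply: measurable_funeM; exact: measurable_Nfun_EFin.
  - by move=> x _; rewrite lee_fin Nfun_divD.
rewrite ge0_integralD //; first last.
- by apply: measurable_funeM; exact: measurable_Nfun_EFin.
- by move=> x _; rewrite mule_ge0 ?lee_fin // Nfun_ge0.
- by apply: measurable_funeM; exact: measurable_Nfun_EFin.
- by move=> x _; rewrite mule_ge0 ?lee_fin // Nfun_ge0.
rewrite !ge0_integralZl_EFin //; last 4 first.
- by move=> x _; rewrite lee_fin Nfun_ge0.
- exact: measurable_Nfun_EFin.
- by move=> x _; rewrite lee_fin Nfun_ge0.
- exact: measurable_Nfun_EFin.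
have -> : (1 = (a / (a + b))%:E * 1 + (b / (a + b))%:E * 1 :> \bar R)%E.
  by rewrite !mule1 -EFinD -mulrDl divff // lt0r_neq0.
by apply: leeD; apply: lee_wpmul2l.
Qed.

(** Since [Phi (t / C) <= Phi t / C], any finite bound on the modular becomes a norm bound at the
    price of the same factor. *)
Lemma modular_le1_scale f k (C : R) : 0 < k -> 1 <= C -> measurable_fun O f ->
  (modular f k <= C%:E)%E -> (modular f (C * k) <= 1)%E.
Proof.
move=> k0 C1 mf fk; have C0 := lt_le_trans ltr01 C1.
apply: (@le_trans _ _ ((C^-1)%:E * modular f k)%E); last first.
  by rewrite muleC lee_pdivrMr // mul1e.
rewrite /modular -ge0_integralZl_EFin //; last 3 first.
- by move=> x _; rewrite lee_fin Nfun_ge0.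
- exact: measurable_Nfun_EFin.
- by rewrite invr_ge0 ltW.
apply: ge0_le_integral => //.
- by move=> x _; rewrite lee_fin Nfun_ge0.
- exact: measurable_Nfun_EFin.
- by apply: measurable_funeM; exact: measurable_Nfun_EFin.
move=> x _; rewrite lee_fin.
have -> : f x / (C * k) = C^-1 * (f x / k) by field; rewrite !lt0r_neq0.
by apply: Nfun_scale; rewrite ?invr_ge0 ?invf_le1 // ltW.
Qed.

Lemma modular_lux f k : 0 < k -> (modular f k <= 1)%E -> (lux_norm mu Phi O f <= k%:E)%E.
Proof. by move=> k0 fk; apply: ereal_inf_lbound; exists k. Qed.

(** The strict bound provides an admissible scale below [k]; monotonicity in the scale then leads up
    to [k]. *)
Lemma lux_modular f k : measurable_fun O f -> (lux_norm mu Phi O f < k%:E)%E ->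
  0 < k /\ (modular f k <= 1)%E.
Proof.
move=> mf /ereal_inf_lt[_ [k' [k'0 fk' ->]]]; rewrite lte_fin => k'k.
split; first exact: lt_trans k'k.
exact: le_trans (modular_le_scale k'0 (ltW k'k) mf) fk'.
Qed.

Lemma lux_ge0 f : (0 <= lux_norm mu Phi O f)%E.
Proof. by apply: le_ereal_inf_tmp => _ [k [k0 _ ->]]; rewrite lee_fin ltW. Qed.

Lemma modular_cst : (mu O < +oo)%E ->
  exists2 c, 0 < c & forall e, 0 < e -> (modular (cst e) (c * e) <= 1)%E.
Proof.
move=> Ofin; have mOE : mu O = (fine (mu O))%:E by rewrite fineK // ge0_fin_numE.
set m := fine (mu O) in mOE; have m0 : 0 <= m by rewrite fine_ge0.
have P0 : 0 <= Phi 1 by exact: Nfun_ge0.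
(* The summand [1] ensures [c >= 1], so that [Phi c^-1 <= c^-1 * Phi 1], while [Phi 1 * m <= c]
   makes the integral at most [1]. *)
exists (Phi 1 * m + 1) => [|e e0]; first by rewrite ltr_wpDl // mulr_ge0.
set c := Phi 1 * m + 1; have c1 : 1 <= c by rewrite lerDr mulr_ge0.
have c0 := lt_le_trans ltr01 c1.
have -> : modular (cst e) (c * e) = ((Phi c^-1)%:E * mu O)%E.
  rewrite /modular -integral_cst //; apply: eq_integral => x _ /=.
  by congr (Phi _)%:E; field; rewrite !lt0r_neq0.
rewrite mOE -EFinM lee_fin.
have h : Phi c^-1 <= c^-1 * Phi 1.
  by rewrite -{1}[c^-1]mulr1; apply: Nfun_scale => //; rewrite ?invr_ge0 ?invf_le1 // ltW.
apply: (le_trans (ler_wpM2r m0 h)).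
by rewrite -mulrA ler_pdivrMl // mulr1 lerDl.
Qed.

Lemma modular_fatou (f_ : nat -> X -> R) f k : 0 < k ->
  (forall n, measurable_fun O (f_ n)) -> measurable_fun O f ->
  (forall n, (modular (f_ n) k <= 1)%E) ->
  {ae mu, forall x, O x -> f_ ^~ x @ \oo --> f x} -> (modular f k <= 1)%E.
Proof.
move=> k0 mf_ mf fk ff; pose F n x := (Phi (f_ n x / k))%:E.
have F0 n x : O x -> (0 <= F n x)%E by rewrite lee_fin Nfun_ge0.
have mF n : measurable_fun O (F n) by exact: measurable_Nfun_EFin.
apply: (le_trans _ (fatou_le mO F0 mF fk)).
apply: ae_ge0_le_integral => //.
- by move=> x _; exact: Nfun_EFin_ge0.
- exact: measurable_Nfun_EFin.
- by move=> x Ox; apply: (@limn_einf_ge _ _ _ 0%N) => n _; exact: F0.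
- exact: measurable_limn_einf.
apply: filterS ff => x fx /fx fxx.
have /cvg_limn_einf_sup[-> _] // : F ^~ x @ \oo --> (Phi (f x / k))%:E.
apply: cvg_EFin; first by near=> n.
have fk' : f_ n x / k @[n --> \oo] --> f x / k by apply: cvgMr_tmp.
have h := @Nfun_continuous _ _ NPhi (f x / k).
have := cvg_comp _ _ fk' h.
exact.
Unshelve. all: by end_near.
Qed.

End Modular.

(** * A Borel-Cantelli argument *)

Section AlmostEverywhere.
Set Implicit Arguments.
Unset Strict Implicit.
Context {R : realType} {dd : measure_display} {X : measurableType dd}
  (mu : {measure set X -> \bar R}) (O : set X).
Hypothesis mO : measurable O.

Lemma sum_half_pow n : \sum_(0 <= k < n) (2^-1 : R) ^+ k <= 2.
Proof.
suff -> : \sum_(0 <= k < n) (2^-1 : R) ^+ k = 2 - 2 * 2^-1 ^+ n.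
  by rewrite lerBlDr lerDl mulr_ge0 // exprn_ge0.
elim: n => [|n IH]; first by rewrite big_nil expr0 mulr1 subrr.
by rewrite big_nat_recr //= IH exprS; lra.
Qed.

(** The sum of the [F n] has finite integral, hence is finite almost everywhere; there its tails
    tend to [0], and each term is bounded by a tail. *)
Lemma borel_cantelli_lt1 (F : nat -> X -> R) C : 0 <= C ->
  (forall n, measurable_fun O (F n)) -> (forall n x, O x -> 0 <= F n x) ->
  (forall n, (\int[mu]_(x in O) (F n x)%:E <= (C * 2^-1 ^+ n)%:E)%E) ->
  {ae mu, forall x, O x -> exists J, forall n, (J <= n)%N -> F n x < 1}.
Proof.
move=> C0 mF F0 FC; pose S x := (\sum_(0 <= n <oo) (F n x)%:E)%E.
have mFE n : measurable_fun O (fun x => (F n x)%:E) by exact/measurable_EFinP.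
have FE0 n x : O x -> (0 <= (F n x)%:E)%E by move=> Ox; rewrite lee_fin F0.
have SC : (\int[mu]_(x in O) S x <= (C * 2)%:E)%E.
  rewrite integral_nneseries //.
  apply: lime_le; first by apply: is_cvg_nneseries => n _ _; apply: integral_ge0 => x; exact: FE0.
  apply: nearW => n; apply: (@le_trans _ _ (\sum_(0 <= k < n) (C * 2^-1 ^+ k)%:E)%E).
    by apply: lee_sum => k _; exact: FC.
  by rewrite sumEFin lee_fin -mulr_sumr ler_wpM2l // sum_half_pow.
have S0 x : O x -> (0 <= S x)%E by move=> Ox; apply: nneseries_ge0 => n _ _; exact: FE0.
have Sint : mu.-integrable O S.
  apply/integrableP; split.
    by apply: ge0_emeasurable_sum => // k x Ox _; exact: FE0.
  have -> : (\int[mu]_(x in O) `|S x| = \int[mu]_(x in O) S x)%E.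
    by apply: eq_integral => x; rewrite inE => Ox; rewrite gee0_abs // S0.
  by rewrite (le_lt_trans SC) // ltry.
apply: filterS (integrable_ae mO Sint) => x Sx Ox; have {}Sx := Sx Ox.
have [|n _|J _ tJ] := @nneseries_tail_cvg R (fun n => (F n x)%:E) xpredT _ _
    _ (@nbhs_open_ereal_lt R 0 (fun r => r + 1) (ltr_pwDr ltr01 (lexx 0))).
- by move: Sx; rewrite ge0_fin_numE // S0.
- exact: FE0.
exists J => n /tJ /=; rewrite add0r -lte_fin; apply: le_lt_trans.
apply: le_trans (@nneseries_lim_ge R _ xpredT n n.+1 _); last by move=> k _ _; exact: FE0.
by rewrite big_nat1.
Qed.

End AlmostEverywhere.

Section FastCauchy.
Set Implicit Arguments.
Unset Strict Implicit.
Context {R : realType} {Z : Type} (dZ : Z -> Z -> R).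
Hypothesis Zm : is_metric dZ.

Lemma half_pow_cauchy (u : nat -> Z) J :
  (forall n, (J <= n)%N -> dZ (u n) (u n.+1) <= 2^-1 ^+ n) ->
  forall e, 0 < e -> exists N, forall n m, (N <= n)%N -> (N <= m)%N -> dZ (u n) (u m) < e.
Proof.
have [d0 [dE [ds dt]]] := Zm.
move=> uJ e e0; have [N hN] := half_pow_lt (divr_gt0 e0 (ltr0n _ 2)).
have tail n k : (J <= n)%N -> dZ (u n) (u (n + k)%N) <= 2 * 2^-1 ^+ n - 2 * 2^-1 ^+ (n + k).
  move=> Jn; elim: k => [|k IH].
    by rewrite addn0 subrr (_ : dZ _ _ = 0) //; exact/dE.
  rewrite addnS exprS; have := uJ (n + k)%N (leq_trans Jn (leq_addr _ _)).
  by have := dt (u n) (u (n + k)%N) (u (n + k).+1); lra.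
have key n m : (maxn N J <= n)%N -> (n <= m)%N -> dZ (u n) (u m) < e.
  rewrite geq_max => /andP[Nn Jn] nm; have := tail n (m - n)%N Jn; rewrite subnKC //.
  by have := hN n Nn; have := @half_pow_gt0 R m; lra.
exists (maxn N J) => n m Nn Nm; have [nm|/ltnW mn] := leqP n m; first exact: key.
by rewrite ds; exact: key.
Qed.

End FastCauchy.

(** * Almost everywhere convergent midpoints of a bounded sequence *)

Section ConvexCombinations.
Set Implicit Arguments.
Unset Strict Implicit.
Context {R : realType} {dd : measure_display} {X : measurableType dd}
  (mu : {measure set X -> \bar R}) (Phi : R -> R) (O : set X).
Hypothesis NPhi : N_function Phi.
Hypothesis mO : measurable O.
Hypothesis finO : (mu O < +oo)%E.
Context (g : nat -> X -> R) (k : R).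
Hypothesis k0 : 0 < k.
Hypothesis mg : forall n, measurable_fun O (g n).
Hypothesis g0 : forall n x, 0 <= g n x.
Hypothesis gk : forall n, (modular mu Phi O (g n) k <= 1)%E.

(* Midpoints suffice in place of all convex combinations. *)
Inductive midpoint_hull (n : nat) : (X -> R) -> Prop :=
| hull_base m of (n <= m)%N : midpoint_hull n (g m)
| hull_mid f f' of midpoint_hull n f & midpoint_hull n f' :
    midpoint_hull n (fun x => (f x + f' x) / 2).

Lemma hull_ge0 n f : midpoint_hull n f -> forall x, 0 <= f x.
Proof.
elim=> [m _ x|f1 f2 _ h1 _ h2 x]; first exact: g0.
by rewrite divr_ge0 // addr_ge0.
Qed.

Lemma hull_measurable n f : midpoint_hull n f -> measurable_fun O f.
Proof.
elim=> [m _|f1 f2 _ h1 _ h2]; first exact: mg.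
by apply: measurable_funM; [exact: measurable_funD | exact: measurable_cst].
Qed.

Lemma hull_modular n f : midpoint_hull n f -> (modular mu Phi O f k <= 1)%E.
Proof.
elim=> [m _|f1 f2 hf1 h1 hf2 h2]; first exact: gk.
have := modularD_le1 NPhi mO k0 k0 (hull_measurable hf1) (hull_measurable hf2) h1 h2.
rewrite (_ : modular mu Phi O (f1 \+ f2)%R (k + k) =
  modular mu Phi O (fun x => (f1 x + f2 x) / 2) k) //.
apply: eq_integral => x _ /=; congr (Phi _)%:E.
by field; rewrite !lt0r_neq0 ?addr_gt0.
Qed.

Lemma hull_sub n m f : (n <= m)%N -> midpoint_hull m f -> midpoint_hull n f.
Proof.
move=> nm; elim=> [p mp|f1 f2 _ h1 _ h2]; last exact: hull_mid.
by apply: hull_base; exact: leq_trans mp.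
Qed.

(** Affine inequalities pass to midpoints; with [c] the distance of [x] and [x'] this is the Hajlasz
    inequality. *)
Lemma hull_ineq n f : midpoint_hull n f -> forall x x' (b c : R),
  (forall m, (n <= m)%N -> b <= c * (g m x + g m x')) -> b <= c * (f x + f x').
Proof.
elim=> [m nm x x' b c|f1 f2 _ h1 _ h2 x x' b c bc]; first exact.
by have := h1 _ _ _ _ bc; have := h2 _ _ _ _ bc; lra.
Qed.

Definition exp_integral (f : X -> R) : R := fine (\int[mu]_(x in O) (expR (- f x))%:E).

Lemma measurable_exp (f : X -> R) : measurable_fun O f ->
  measurable_fun O (fun x => (expR (f x))%:E).
Proof. by move=> mf; apply/measurable_EFinP; apply: measurableT_comp. Qed.

Lemma exp_integralE (f : X -> R) : measurable_fun O f -> (forall x, 0 <= f x) ->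
  (\int[mu]_(x in O) (expR (- f x))%:E = (exp_integral f)%:E)%E /\
  0 <= exp_integral f <= fine (mu O).
Proof.
move=> mf f0.
have le : (\int[mu]_(x in O) (expR (- f x))%:E <= mu O)%E.
  rewrite -[leRHS]mul1e -integral_cst //; apply: ge0_le_integral => //.
  - by apply: measurable_exp; apply: measurableT_comp.
  - by move=> x _; rewrite lee_fin -expR0 ler_expR oppr_le0.
have ge : (0 <= \int[mu]_(x in O) (expR (- f x))%:E)%E.
  by apply: integral_ge0 => x _; rewrite lee_fin expR_ge0.
have fn : (\int[mu]_(x in O) (expR (- f x))%:E)%E \is a fin_num.
  by rewrite ge0_fin_numE // (le_lt_trans le).
rewrite /exp_integral fineK //; split => //.
by rewrite fine_ge0 //= fine_le // ge0_fin_numE.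
Qed.

(* Strict convexity in quantitative form: near-minimisers of [exp_integral] have
   [expR (- f / 2)] close in L^2. *)
Lemma exp_integral_gap (f f' : X -> R) : measurable_fun O f -> measurable_fun O f' ->
  (forall x, 0 <= f x) -> (forall x, 0 <= f' x) ->
  (\int[mu]_(x in O) ((expR (- (f x / 2)) - expR (- (f' x / 2))) ^+ 2)%:E =
   (exp_integral f + exp_integral f'
     - 2 * exp_integral (fun x => (f x + f' x) / 2))%:E)%E.
Proof.
move=> mf mf' f0 f'0.
have mh : measurable_fun O (fun x => (f x + f' x) / 2).
  by apply: measurable_funM; [exact: measurable_funD | exact: measurable_cst].
have h0 x : 0 <= (f x + f' x) / 2 by rewrite divr_ge0 // addr_ge0.
have [Ef _] := exp_integralE mf f0; have [Ef' _] := exp_integralE mf' f'0.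
have [Eh _] := exp_integralE mh h0.
set D := (\int[mu]_(x in O) _)%E.
(* The identity is [(a - b) ^ 2 + 2 a b = a ^ 2 + b ^ 2], where [a b] is exactly the integrand of
   the midpoint. In this form only nonnegative integrals are added. *)
have : (D + (2 * exp_integral (fun x => (f x + f' x) / 2))%:E
    = (exp_integral f)%:E + (exp_integral f')%:E)%E.
  rewrite EFinM -Eh -Ef -Ef' -ge0_integralZl_EFin //; last first.
    by apply: measurable_exp; apply: measurableT_comp.
  have mD : measurable_fun O (fun x =>
      ((expR (- (f x / 2)) - expR (- (f' x / 2))) ^+ 2)%:E).
    have me (q : X -> R) : measurable_fun O q -> measurable_fun O (fun x => expR (- (q x / 2))).
      move=> mq; apply: measurableT_comp => //; apply: measurableT_comp => //.
      by apply: measurable_funM => //; exact: measurable_cst.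
    apply/measurable_EFinP; apply: measurable_funX.
    by apply: measurable_funB; exact: me.
  have me (q : X -> R) : measurable_fun O q -> measurable_fun O (fun x => (expR (- q x))%:E).
    by move=> mq; apply: measurable_exp; apply: measurableT_comp.
  have e0 (q : X -> R) x : (0 <= (expR (- q x))%:E)%E by rewrite lee_fin expR_ge0.
  rewrite -ge0_integralD //; first last.
  - by apply: measurable_funeM; exact: me.
  - by move=> x _; rewrite lee_fin sqr_ge0.
  rewrite -ge0_integralD //; [|exact: me|exact: me].
  apply: eq_integral => x _; rewrite -EFinM -!EFinD; congr (_%:E).
  have E2 (y : R) : expR (- y) = expR (- (y / 2)) ^+ 2.
    by rewrite expr2 -expRD; congr expR; lra.
  have -> : expR (- ((f x + f' x) / 2)) = expR (- (f x / 2)) * expR (- (f' x / 2)).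
    by rewrite -expRD; congr expR; lra.
  by rewrite (E2 (f x)) (E2 (f' x)); ring.
by case: D => [r| |] //= [E]; congr (_%:E); lra.
Qed.

Let h : R := 2^-1.

Lemma hull_fast_cauchy : exists f : nat -> X -> R,
  (forall l, exists2 n, (l <= n)%N & midpoint_hull n (f l)) /\
  forall l, (\int[mu]_(x in O)
    ((2 ^+ l * (expR (- (f l x / 2)) - expR (- (f l.+1 x / 2)))) ^+ 2)%:E
      <= (4 * h ^+ l)%:E)%E.
Proof.
pose I n := [set exp_integral f | f in midpoint_hull n].
have I0 n : I n !=set0 by exists (exp_integral (g n)), (g n) => //; exact: hull_base.
have IB n r : I n r -> 0 <= r <= fine (mu O).
  by move=> [f fn <-]; apply: (exp_integralE _ _).2; [exact: hull_measurable fn|exact: hull_ge0 fn].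
pose i n := inf (I n).
have i_le n f : midpoint_hull n f -> i n <= exp_integral f.
  move=> fn; apply: ge_inf; last by exists f.
  by exists 0 => r /IB/andP[].
have i_mono n m : (n <= m)%N -> i n <= i m.
  move=> nm; apply: lb_le_inf => // _ [f fm <-].
  by apply: i_le; exact: hull_sub fm.
have ub : has_sup (range i).
  split; first by exists (i 0%N), 0%N.
  exists (fine (mu O)) => _ [n _ <-]; apply: (le_trans (i_le n _ (hull_base (leqnn n)))).
  by have /IB/andP[] : I n (exp_integral (g n)) by exists (g n) => //; exact: hull_base.
(* [eta l] is [8 ^ - l]: the weight [4 ^ l] in the claim uses up two of the three powers and leaves
   a summable [2 ^ - l]. *)
pose s := sup (range i); pose eta l : R := h ^+ l * h ^+ l * h ^+ l.
have hl0 l : 0 < h ^+ l by exact: half_pow_gt0.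
have eta0 l : 0 < eta l by rewrite !mulr_gt0.
have i_s n : i n <= s by apply: ub_le_sup; [exact: ub.2 | exists n].
have eta_mono l : eta l.+1 <= eta l.
  have hle : h ^+ l.+1 <= h ^+ l by exact: half_pow_le.
  have h0 j := ltW (hl0 j).
  by rewrite /eta; apply: ler_pM => //; [exact: mulr_ge0 | exact: ler_pM].
have near_s l : exists n, (l <= n)%N /\ s - eta l <= i n.
  have [_ [n _ <-] hn] := sup_adherent (eta0 l) ub.
  exists (maxn l n); split; first exact: leq_maxl.
  by apply: ltW; apply: (lt_le_trans hn); exact: i_mono (leq_maxr _ _).
have [n nP] := choice near_s.
have near_i l : exists f, midpoint_hull (n l) f /\ exp_integral f <= i (n l) + eta l.
  have hasI : has_inf (I (n l)) by split => //; exists 0 => r /IB/andP[].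
  have [_ [f fn <-] hf] := inf_adherent (eta0 l) hasI.
  by exists f; split => //; exact: ltW.
have [f fP] := choice near_i.
exists f; split => l; first by exists (n l); [exact: (nP l).1 | exact: (fP l).1].
have mf j := hull_measurable (fP j).1; have f0 j := hull_ge0 (fP j).1.
have -> : (\int[mu]_(x in O)
    ((2 ^+ l * (expR (- (f l x / 2)) - expR (- (f l.+1 x / 2)))) ^+ 2)%:E =
  (2 ^+ l * 2 ^+ l)%:E * \int[mu]_(x in O)
    ((expR (- (f l x / 2)) - expR (- (f l.+1 x / 2))) ^+ 2)%:E)%E.
  rewrite -ge0_integralZl_EFin //.
  - by apply: eq_integral => x _; rewrite -EFinM; congr (_%:E); ring.
  - by move=> x _; rewrite lee_fin sqr_ge0.
  - have me j : measurable_fun O (fun x => expR (- (f j x / 2))).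
      apply: measurableT_comp => //; apply: measurableT_comp => //.
      by apply: measurable_funM => //; exact: measurable_cst.
    apply/measurable_EFinP; apply: measurable_funX.
    by apply: measurable_funB; exact: me.
rewrite exp_integral_gap // -EFinM lee_fin.
set gap := (X in _ * X); have gap_le : gap <= 4 * eta l.
  (* Both functions have integral at most [s + eta l], so this lower bound for their midpoint gives
     the gap [4 * eta l]. As [n] need not be monotone, the midpoint is placed in the hull of the
     smaller tail index. *)
  have mid : s - eta l <= exp_integral (fun x => (f l x + f l.+1 x) / 2).
    pose p := minn (n l) (n l.+1).
    apply: (@le_trans _ _ (i p)).
      rewrite /p; case: leqP => _; first exact: (nP l).2.
      by have := (nP l.+1).2; have := eta_mono l; lra.
    apply: i_le; apply: hull_mid.
      by apply: hull_sub (fP l).1; exact: geq_minl.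
    by apply: hull_sub (fP l.+1).1; exact: geq_minr.
  have := (fP l).2; have := (fP l.+1).2; have := i_s (n l); have := i_s (n l.+1).
  by have := eta_mono l; rewrite /gap; lra.
have c0 : 0 <= (2 : R) ^+ l * 2 ^+ l by rewrite mulr_ge0 // exprn_ge0.
apply: (le_trans (ler_wpM2l c0 gap_le)).
have e1 : (2 : R) ^+ l * h ^+ l = 1 by rewrite -exprMn /h divff // expr1n.
rewrite le_eqVlt; apply/orP; left; apply/eqP.
have -> : 2 ^+ l * 2 ^+ l * (4 * eta l) = 4 * (2 ^+ l * h ^+ l) * (2 ^+ l * h ^+ l) * h ^+ l.
  by rewrite /eta; ring.
by rewrite e1 !mulr1.
Qed.

Lemma hull_ae_cvg : exists (f_ : nat -> X -> R) (f : X -> R),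
  [/\ forall l, exists2 n, (l <= n)%N & midpoint_hull n (f_ l),
      forall x, 0 <= f x, measurable_fun O f &
      {ae mu, forall x, O x -> f_ ^~ x @ \oo --> f x}].
Proof.
have [f_ [f_hull f_cauchy]] := hull_fast_cauchy.
have f0 l x : 0 <= f_ l x by have [n _ /hull_ge0] := f_hull l.
have mf l : measurable_fun O (f_ l) by have [n _ /hull_measurable] := f_hull l.
have fk l : (\int[mu]_(x in O) (Phi (f_ l x / k))%:E <= 1)%E.
  by have [n _ /hull_modular] := f_hull l.
(* The lower limit exists everywhere, which makes [f] measurable and nonnegative also off the set of
   convergence. *)
pose f x := fine (limn_einf (fun l => (f_ l x)%:E)).
have mfE l : measurable_fun O (fun x => (f_ l x)%:E) by exact/measurable_EFinP.
exists f_, f; split => //.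
- by move=> x; apply/fine_ge0/(@limn_einf_ge _ _ _ 0%N) => n _; rewrite lee_fin.
- apply: (measurableT_comp (@fine_measurable R _ measurableT)).
  exact: (measurable_limn_einf mfE).
pose q l x := expR (- (f_ l x / 2)).
have mq l : measurable_fun O (q l).
  apply: measurableT_comp => //; apply: measurableT_comp => //.
  by apply: measurable_funM => //; exact: measurable_cst.
have ae_cauchy : {ae mu, forall x, O x -> exists J, forall l, (J <= l)%N ->
    (2 ^+ l * (q l x - q l.+1 x)) ^+ 2 < 1}.
  apply: (@borel_cantelli_lt1 _ _ _ mu O mO _ 4) => //.
  - move=> l; apply: measurable_funX; apply: measurable_funM; first exact: measurable_cst.
    exact: measurable_funB.
  - by move=> l x _; rewrite sqr_ge0.
pose F l x := (Phi (f_ l x / k))%:E.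
have mF l : measurable_fun O (F l) by exact: measurable_Nfun_EFin.
have F0 l x : O x -> (0 <= F l x)%E by rewrite lee_fin Nfun_ge0.
have ae_fin : {ae mu, forall x, O x -> limn_einf (F ^~ x) \is a fin_num}.
  apply: (integrable_ae mO); apply/integrableP; split; first exact: measurable_limn_einf.
  have -> : (\int[mu]_(x in O) `|limn_einf (F ^~ x)| = \int[mu]_(x in O) limn_einf (F ^~ x))%E.
    apply: eq_integral => x; rewrite inE => Ox; rewrite gee0_abs //.
    by apply: (@limn_einf_ge _ _ _ 0%N) => n _; exact: F0.
  by apply: (le_lt_trans (fatou_le mO F0 mF fk)); rewrite ltry.
apply: filterS2 ae_cauchy ae_fin => x qx Fx Ox; have [J {}qx] := qx Ox; have {}Fx := Fx Ox.
have [y qy] : exists y, forall e, 0 < e ->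
    exists N, forall n, (N <= n)%N -> `|q n x - y| < e.
  apply: real_cauchy => e e0.
  have Rm : is_metric (fun a b : R => `|a - b|).
    split=> [a b|]; first exact: normr_ge0.
    split=> [a b|]; first by split => [/normr0_eq0/eqP|->]; rewrite ?subr_eq0 ?subrr ?normr0 // => /eqP.
    split=> [a b|a b c]; first by rewrite distrC.
    exact: ler_distD.
  apply: (@half_pow_cauchy R R _ Rm (q ^~ x) J _ e e0) => l Jl.
  have := qx l Jl; rewrite -real_normK ?num_real // expr_lt1 // normrM.
  rewrite ger0_norm ?exprn_ge0 // mulrC -ltr_pdivlMr ?exprn_gt0 // div1r -exprVn.
  exact: ltW.
(* The exponentials also converge, to [0], where [f_] escapes to infinity. With
   [t * Phi 1 >= L + 1], linear growth of [Phi] would there push the lower limit of [Phi (f_ / k)]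
   above its finite value [L]. *)
have y_gt0 : 0 < y.
  rewrite ltNge; apply/negP => y_le0.
  pose L := fine (limn_einf (F ^~ x)); pose t := Num.max 1 ((L + 1) / Phi 1).
  have P1 : 0 < Phi 1 by apply: Nfun_gt0 => //; exact: oner_neq0.
  have t1 : 1 <= t by rewrite le_max lexx.
  have [N qN] := qy _ (expR_gt0 (- (k * t / 2))).
  have : ((L + 1)%:E <= limn_einf (F ^~ x))%E.
    apply: (@limn_einf_ge _ _ _ N) => n /qN qn; rewrite lee_fin.
    have : q n x < expR (- (k * t / 2)).
      by have := le_lt_trans (ler_norm _) qn; lra.
    rewrite /q ltr_expR => kt.
    have tf : t <= f_ n x / k by rewrite ler_pdivlMr // mulrC; lra.
    have f1 : 1 <= `|f_ n x / k| by rewrite (le_trans (le_trans t1 tf)) // ler_norm.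
    apply: le_trans (Nfun_linear NPhi f1); rewrite -ler_pdivrMr //.
    apply: (@le_trans _ _ t); first by rewrite le_max lexx orbT.
    by rewrite (le_trans tf) // ler_norm.
  rewrite -[limn_einf _]fineK // lee_fin -/L; lra.
have cv : f_ ^~ x @ \oo --> -2 * ln y.
  have qc : q ^~ x @ \oo --> y by apply/cvg_natP.
  have -> : f_ ^~ x = fun n => -2 * ln (q n x).
    by apply/funext => n; rewrite /q expRK; lra.
  have lnc : ln (q n x) @[n --> \oo] --> ln y.
    have cl := continuous_ln y_gt0.
    have := cvg_comp _ _ qc cl.
    exact.
  have c2 : (fun _ : nat => - 2 : R) @ \oo --> (- 2 : R) by exact: cvg_cst.
  have := cvgM c2 lnc.
  exact.
have fE : f x = -2 * ln y.
  rewrite /f; have /cvg_limn_einf_sup[-> _] // : (fun l => (f_ l x)%:E) @ \oo --> (-2 * ln y)%:E.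
  apply: cvg_EFin; first exact: nearW.
  exact: cv.
by rewrite fE.
Qed.

(** The inequality is asked only up to [e] and for large [n] because in its application [b] is a
    distance for the limit map, whereas [g n] controls the approximating map. *)
Lemma convex_limit : exists (f : X -> R) (N : set X),
  [/\ forall x, 0 <= f x, measurable_fun O f, (modular mu Phi O f k <= 1)%E,
      mu.-negligible N &
      forall x x' (b c : R), O x -> O x' -> ~ N x -> ~ N x' ->
        (forall e, 0 < e -> exists n0, forall n, (n0 <= n)%N -> b - e <= c * (g n x + g n x')) ->
        b <= c * (f x + f x')].
Proof.
have [f_ [f [f_hull f0 mf f_f]]] := hull_ae_cvg.
exists f, (~` [set x | O x -> f_ ^~ x @ \oo --> f x]); split => //.
  apply: (modular_fatou NPhi mO k0) f_f => // l; have [n _ fn] := f_hull l.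
    exact: hull_measurable fn.
  exact: hull_modular fn.
move=> x x' b c Ox Ox' /contrapT /(_ Ox) fx /contrapT /(_ Ox') fx' bc.
apply/ler_addgt0Pr => e /bc[n0 {}bc]; rewrite -lerBlDr.
have cv : (fun l => c * (f_ l x + f_ l x')) @ \oo --> c * (f x + f x').
  by apply: cvgMl_tmp; exact: cvgD.
rewrite -(cvg_lim _ cv) //; apply: limr_ge; first exact: cvgP cv.
exists n0 => // l /= n0l; have [n ln fn] := f_hull l.
by apply: (hull_ineq fn) => m nm; apply: bc; exact: leq_trans n0l (leq_trans ln nm).
Qed.

End ConvexCombinations.

Lemma mball_open {R : realType} {T : Type} (d : T -> T -> R) x r :
  is_metric d -> mopen d (mball d x r).
Proof.
move=> [_ [_ [_ dt]]] y; rewrite /mball /= => xy; exists (r - d x y).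
  by rewrite subr_gt0.
by move=> z /= yz; have := dt x y z; lra.
Qed.

Lemma mopen_preimage_isometry {R : realType} {S T : Type} (dS : S -> S -> R) (dT : T -> T -> R)
  (f : S -> T) A : isometric_embedding dS dT f -> mopen dT A -> mopen dS (f @^-1` A).
Proof.
move=> fi Aop x /= /Aop[r r0 rA]; exists r => // y /= xy.
by apply: rA; rewrite /mball /= fi.
Qed.

(** * Volumes of balls and total boundedness under doubling *)

Section Doubling.
Set Implicit Arguments.
Unset Strict Implicit.
Context {R : realType} {dd : measure_display} {X : measurableType dd}
  (dX : X -> X -> R) (mu : {measure set X -> \bar R}).
Hypothesis Xm : is_metric dX.
Hypothesis mop : forall A, mopen dX A -> measurable A.
Hypothesis dbl : doubling dX mu.

Lemma measurable_mball x r : measurable (mball dX x r).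
Proof. by apply: mop; exact: mball_open. Qed.

Lemma measure_mball_gt0 x r : 0 < r -> (0 < mu (mball dX x r))%E.
Proof.
move=> r0; have [Cd h] := dbl; have [] := h x (r / 2) (divr_gt0 r0 (ltr0n _ 2)).
by rewrite mulrC divfK // pnatr_eq0.
Qed.

Lemma measure_mball_fin x r : (mu (mball dX x r) < +oo)%E.
Proof.
have [r0|r0] := ltP 0 r.
  have [Cd h] := dbl; have [] := h x (r / 2) (divr_gt0 r0 (ltr0n _ 2)).
  by rewrite mulrC divfK // pnatr_eq0.
rewrite (_ : mball dX x r = set0) ?measure0 //.
rewrite -subset0 => y; rewrite /mball /= => xy.
by have [d0 _] := Xm; have := d0 x y; lra.
Qed.

Let v x r := fine (mu (mball dX x r)).

Lemma measure_mballE x r : mu (mball dX x r) = (v x r)%:E.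
Proof. by rewrite fineK // ge0_fin_numE // measure_mball_fin. Qed.

Lemma volume_gt0 x r : 0 < r -> 0 < v x r.
Proof. by move=> /(measure_mball_gt0 x); rewrite measure_mballE lte_fin. Qed.

Lemma volume_le x r x' r' : mball dX x r `<=` mball dX x' r' -> v x r <= v x' r'.
Proof.
move=> sub; rewrite -lee_fin -!measure_mballE; apply: le_measure => //;
  rewrite inE; exact: measurable_mball.
Qed.

Lemma volume_doubling : exists2 C, 0 < C & forall x r q, 0 < r ->
  v x (2 ^+ q * r) <= C ^+ q * v x r.
Proof.
have [C h] := dbl.
have h1 x r : 0 < r -> v x (2 * r) <= C * v x r.
  by move=> r0; have [_ + _] := h x r r0; rewrite !measure_mballE -EFinM lee_fin.
have x0 : X by exact: point.
have C0 : 0 < C.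
  have := h1 x0 1 ltr01; have := @volume_gt0 x0 (2 * 1) (mulr_gt0 (ltr0n _ 2) ltr01).
  have := @volume_gt0 x0 1 ltr01 => a b c.
  by rewrite -(pmulr_lgt0 C a); lra.
exists C => // x r q r0; elim: q => [|q IH]; first by rewrite !expr0 !mul1r.
rewrite !exprS -!mulrA; apply: (le_trans (h1 _ _ _)); first by rewrite mulr_gt0 // exprn_gt0.
by rewrite ler_wpM2l // ltW.
Qed.

(** Otherwise there is an infinite [e]-separated sequence; its balls of radius [e / 2] are disjoint,
    lie in one ball of finite volume, and have volumes bounded below by doubling. *)
Lemma mball_totally_bounded x0 r : totally_bounded dX (mball dX x0 r).
Proof.
have [d0 [dE [ds dt]]] := Xm.
move=> e e0; apply: contrapT => noc.
have /choice[pick pickP] (s : seq X) : exists x, mball dX x0 r x /\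
    forall j, (j < size s)%N -> e <= dX (nth x0 s j) x.
  apply: contrapT => /forallNP nx; apply: noc; exists (size s), (nth x0 s) => x Bx.
  have /not_andP[//|/existsNP[j /not_implyP[js /negP]]] := nx x.
  by rewrite -ltNge => jx; exists j.
pose L := fix L n := if n is n'.+1 then rcons (L n') (pick (L n')) else [::].
pose x n := pick (L n).
have sL n : size (L n) = n by elim: n => //= n IH; rewrite size_rcons IH.
have nL n j : (j < n)%N -> nth x0 (L n) j = x j.
  elim: n => // n IH; rewrite ltnS leq_eqVlt => /predU1P[->|jn] /=.
    by rewrite nth_rcons sL ltnn eqxx.
  by rewrite nth_rcons sL jn IH.
have sep j n : (j < n)%N -> e <= dX (x j) (x n).
  by move=> jn; rewrite -(nL n) //; apply: (pickP (L n)).2; rewrite sL.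
have Bx n : dX x0 (x n) < r by exact: (pickP (L n)).1.
have e20 : 0 < e / 2 by rewrite divr_gt0.
have [C C0 Cv] := volume_doubling.
have r0 : 0 < r by exact: le_lt_trans (d0 _ _) (Bx 0%N).
(* After [q] doublings the ball of radius [e / 2] about any [x n] contains the one about [x0],
   whence the common lower bound [b]. *)
have [q hq] : exists q, e / 2 + r <= 2 ^+ q * (e / 2).
  have [N /(_ N (leqnn N))] := half_pow_lt (divr_gt0 e20 (addr_gt0 e20 r0)).
  rewrite exprVn ltr_pdivlMr ?addr_gt0 // mulrC ltr_pdivrMr ?exprn_gt0 // => hN.
  by exists N; rewrite [leRHS]mulrC ltW.
pose b := v x0 (e / 2) / C ^+ q.
have b0 : 0 < b by rewrite divr_gt0 ?exprn_gt0 // volume_gt0.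
have bv n : b <= v (x n) (e / 2).
  rewrite ler_pdivrMr ?exprn_gt0 // [leRHS]mulrC; apply: le_trans (Cv _ _ _ e20).
  apply: volume_le => y; rewrite /mball /= => xy.
  have := dt (x n) x0 y; have := Bx n; rewrite (ds (x n) x0); lra.
pose A n := mball dX (x n) (e / 2).
have mA n : measurable (A n) by exact: measurable_mball.
have tA : trivIset setT A.
  apply/trivIsetP => i j _ _ ij; rewrite -subset0 => y; rewrite /A /mball /= => -[iy jy].
  wlog lij : i j ij iy jy / (i < j)%N.
    move=> H; have [ltij|ltji|eij] := ltngtP i j; last by rewrite eij eqxx in ij.
      exact: (H i j).
    by apply: (H j i) => //; rewrite eq_sym.
  by have := sep _ _ lij; have := dt (x i) y (x j); rewrite (ds y); lra.
have bound n : n%:R * b <= v x0 (r + e).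
  rewrite -lee_fin -measure_mballE.
  apply: (@le_trans _ _ (mu (\big[setU/set0]_(i < n) A i))); last first.
    apply: le_measure; rewrite ?inE; [exact: bigsetU_measurable|exact: measurable_mball|].
    rewrite -bigcup_mkord => y [i _]; rewrite /A /mball /= => iy.
    by have := dt x0 (x i) y; have := Bx i; lra.
  rewrite measure_bigsetU //; apply: (@le_trans _ _ (\sum_(i < n) b%:E)%E).
    by rewrite sumEFin lee_fin sumr_const card_ord mulr_natl.
  by apply: lee_sum => i _; rewrite [leRHS](measure_mballE (x i) (e / 2)) lee_fin.
have := archi_boundP (ltW (divr_gt0 (volume_gt0 x0 (addr_gt0 r0 e0)) b0)).
by rewrite ltr_pdivrMr // ltNge bound.
Qed.

End Doubling.

(** * Maps with countably many values on measurable pieces *)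

Section StepMaps.
Set Implicit Arguments.
Unset Strict Implicit.
Context {R : realType} {dd : measure_display} {X : measurableType dd} (O : set X).
Hypothesis mO : measurable O.

Definition measurable_index (iota : X -> nat) :=
  forall i, measurable (O `&` iota @^-1` [set i]).

Lemma index_bigcup (iota : X -> nat) : O = \bigcup_i (O `&` iota @^-1` [set i]).
Proof. by apply/seteqP; split=> [x Ox|x [i _ []]//]; exists (iota x). Qed.

Lemma measurable_fun_index iota (f : X -> R) : measurable_index iota ->
  (forall i, measurable_fun (O `&` iota @^-1` [set i]) f) -> measurable_fun O f.
Proof.
by move=> mi mf; rewrite (index_bigcup iota); apply/measurable_fun_bigcup.
Qed.

Context {Z : Type} (dZ : Z -> Z -> R).
Hypothesis Zm : is_metric dZ.

Lemma measurable_dist_cst (u : X -> Z) z : mmeasurable dZ O u ->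
  measurable_fun O (fun x => dZ z (u x)).
Proof.
move=> mu; apply: (measurability (@RGenInftyO.G R)) (RGenInftyO.measurableE R) _.
move=> _ [_ [r ->] <-].
rewrite (_ : _ `&` _ = O `&` u @^-1` mball dZ z r); first exact/mu/mball_open.
by apply/seteqP; split=> x [Ox]; rewrite /= in_itv.
Qed.

(* Countably many values on measurable pieces, so that preimages of arbitrary sets are
   measurable: this replaces separability of the target. *)
Definition step_map (w : X -> Z) := exists iota (z : nat -> Z),
  measurable_index iota /\ forall x, O x -> w x = z (iota x).

Lemma step_map_measurable w A : step_map w -> measurable (O `&` w @^-1` A).
Proof.
move=> [iota [z [mi wz]]].
rewrite (_ : _ `&` _ = \bigcup_(i in [set i | A (z i)]) (O `&` iota @^-1` [set i])).
  exact: bigcup_measurable.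
apply/seteqP; split=> [x [Ox]|x [i /= Azi [Ox /= xi]]].
  by rewrite /= wz // => Azx; exists (iota x).
by split=> //=; rewrite wz // xi.
Qed.

(** For a nonseparable target the distance of two measurable maps may fail to be measurable; if one
    is a step map, each piece involves only the distance to a constant. *)
Lemma step_map_dist (u w : X -> Z) : mmeasurable dZ O u -> step_map w ->
  measurable_fun O (fun x => dZ (u x) (w x)).
Proof.
have [_ [_ [ds _]]] := Zm.
move=> mu [iota [z [mi wz]]]; apply: (measurable_fun_index mi) => i.
apply: (eq_measurable_fun (fun x => dZ (z i) (u x))).
  by move=> x; rewrite inE => -[Ox /= xi]; rewrite wz // xi ds.
apply: measurable_funS (measurable_dist_cst (z i) mu) => //.
Qed.

Lemma step_map_mmeasurable w : step_map w -> mmeasurable dZ O w.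
Proof. by move=> sw A _; exact: step_map_measurable. Qed.

(** The limit lies in the open set [A] exactly when, for some [k], the ball of radius [2^-1 ^+ k]
    about [w n x] eventually stays in [A]. The sets [Ak k] may be arbitrary, since step maps have
    measurable preimages of all sets. *)
Lemma limit_mmeasurable (w : nat -> X -> Z) v : (forall n, step_map (w n)) ->
  (forall x, O x -> forall e, 0 < e -> exists N, forall n, (N <= n)%N -> dZ (w n x) (v x) < e) ->
  mmeasurable dZ O v.
Proof.
have [_ [_ [ds dt]]] := Zm.
move=> sw wv A Aop; pose Ak k := [set z | mball dZ z (2^-1 ^+ k) `<=` A].
rewrite (_ : O `&` v @^-1` A = \bigcup_k \bigcup_N \bigcap_(n in [set n | (N <= n)%N])
    (O `&` w n @^-1` Ak k)).
  apply: bigcupT_measurable => k; apply: bigcupT_measurable => N.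
  by apply: bigcap_measurable => [|n _]; [exists N => /= | exact: step_map_measurable].
apply/seteqP; split=> [x [Ox /= /Aop[r r0 rA]]|x [k _ [N _ xN]]].
  have [k /(_ k (leqnn k)) hk] := half_pow_lt (divr_gt0 r0 (ltr0n _ 2)).
  have [N hN] := wv x Ox _ (@half_pow_gt0 R k).
  exists k => //; exists N => // n /= /hN wn; split => //= y; rewrite /mball /= => wy.
  apply: rA; rewrite /mball /=.
  by have := dt (v x) (w n x) y; rewrite (ds (v x) (w n x)); lra.
have [Ox _] := xN N (leqnn N); split => //.
have [M hM] := wv x Ox _ (@half_pow_gt0 R k).
have [_] := xN (maxn N M) (leq_maxl _ _); apply.
by apply: hM; exact: leq_maxr.
Qed.

End StepMaps.

(** * Partition of the domain into small measurable pieces *)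

Section SmallPieces.
Set Implicit Arguments.
Unset Strict Implicit.
Context {R : realType} {dd : measure_display} {X : measurableType dd}
  (dX : X -> X -> R) (O : set X).
Hypothesis Xm : is_metric dX.
Hypothesis mop : forall A, mopen dX A -> measurable A.
Hypothesis mO : measurable O.

Lemma small_pieces : totally_bounded dX O -> forall delta, 0 < delta ->
  exists (N : nat) (iota : X -> nat), [/\ measurable_index O iota,
    forall x, O x -> (iota x < N)%N &
    forall x x', O x -> O x' -> iota x = iota x' -> dX x x' <= delta].
Proof.
have [_ [_ [ds dt]]] := Xm.
move=> tb delta delta0; have [N [c Oc]] := tb _ (divr_gt0 delta0 (ltr0n _ 2)).
pose B j := mball dX (c j) (delta / 2).
have /choice[iota iotaP] x : exists i, O x -> (i < N)%N /\ seqDU B i x.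
  have [Ox|nOx] := pselect (O x); last by exists 0%N.
  have : (\big[setU/set0]_(i < N) seqDU B i) x.
    by rewrite -bigsetU_seqDU -bigcup_mkord; exact: Oc.
  by rewrite -bigcup_mkord => -[i /= iN xi]; exists i.
exists N, iota; split.
- move=> i; rewrite (_ : _ `&` _ = O `&` seqDU B i).
    apply: measurableI => //; apply: measurableD; first exact/mop/mball_open.
    by apply: bigsetU_measurable => j _; exact/mop/mball_open.
  apply/seteqP; split=> x [Ox xi]; split=> //.
    by rewrite -xi; exact: (iotaP x Ox).2.
  have [_ xi'] := iotaP x Ox.
  by apply: (@trivIset_seqDU _ B) => //; exists x.
- by move=> x /iotaP[].
- move=> x x' Ox Ox' xx'.
  have [_ [xi _]] := iotaP x Ox; have [_ [xi' _]] := iotaP x' Ox'.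
  move: xi xi'; rewrite -xx' /B /mball /= => h1 h2.
  by have := dt x (c (iota x)) x'; rewrite (ds x (c _)); lra.
Qed.

End SmallPieces.

(** * Approximation of a single map by a step map *)

Section StepApproximation.
Set Implicit Arguments.
Unset Strict Implicit.
Context {R : realType} {dd : measure_display} {X : measurableType dd}
  (dX : X -> X -> R) (mu : {measure set X -> \bar R}) (Phi : R -> R) (O : set X).
Hypothesis NPhi : N_function Phi.
Hypothesis mO : measurable O.
Hypothesis finO : (mu O < +oo)%E.

Lemma integral_index iota (f : X -> \bar R) : measurable_index O iota ->
  measurable_fun O f -> (forall x, O x -> (0 <= f x)%E) ->
  (\int[mu]_(x in O) f x = \sum_(0 <= i <oo) \int[mu]_(x in O `&` iota @^-1` [set i]) f x)%E.
Proof.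
move=> mi mf f0; rewrite {1}(index_bigcup O iota) ge0_integral_bigcup //.
- by rewrite -index_bigcup.
- by move=> x; rewrite -index_bigcup; exact: f0.
- by apply/trivIsetP => i j _ _ ij; rewrite -subset0 => x [[_ /= xi] [_ /= xj]];
    rewrite -xi -xj eqxx in ij.
Qed.

Context (iota : X -> nat) (delta k : R).
Hypothesis mi : measurable_index O iota.
Hypothesis diam : forall x x', O x -> O x' -> iota x = iota x' -> dX x x' <= delta.
Hypothesis delta0 : 0 < delta.
Hypothesis k0 : 0 < k.

Let A i := O `&` iota @^-1` [set i].

(* Depends on the piece only, hence uniform over the sequence of maps.  On a null piece
   [2 / 0 = 0], and the base point itself is chosen as value. *)
Definition value_bound i : R := k * Num.max 1 ((2 / fine (mu (A i)) + 1) / Phi 1).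

Context {Y : Type} (dY : Y -> Y -> R) (u : X -> Y) (y : Y) (g : X -> R) (N : set X).
Hypothesis Ym : is_metric dY.
Hypothesis u_meas : mmeasurable dY O u.
Hypothesis mg : measurable_fun O g.
Hypothesis g0 : forall x, 0 <= g x.
Hypothesis gk : (modular mu Phi O g k <= 1)%E.
Hypothesis uk : (modular mu Phi O (fun x => dY y (u x)) k <= 1)%E.
Hypothesis negN : mu.-negligible N.
Hypothesis haj : forall x x', O x -> O x' -> ~ N x -> ~ N x' ->
  dY (u x) (u x') <= dX x x' * (g x + g x').

(** The sum lets one chosen point serve twice: the gradient term bounds the error, the distance term
    bounds the value. *)
Let G x := Phi (g x / k) + Phi (dY y (u x) / k).

Lemma energy_ge0 x : 0 <= G x.
Proof. by rewrite addr_ge0 // Nfun_ge0. Qed.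

Lemma measurable_energy : measurable_fun O G.
Proof.
apply: measurable_funD; apply: measurable_Nfun => //.
exact: measurable_dist_cst.
Qed.

Lemma integral_energy_le : (\int[mu]_(x in O) (G x)%:E <= 2%:E)%E.
Proof.
under eq_integral => x _ do rewrite /G EFinD.
rewrite ge0_integralD //.
- by rewrite (_ : 2%:E = 1 + 1)%E; [exact: leeD | rewrite -EFinD].
- by move=> x _; rewrite lee_fin Nfun_ge0.
- exact: measurable_Nfun_EFin.
- by move=> x _; rewrite lee_fin Nfun_ge0.
- by apply: measurable_Nfun_EFin => //; exact: measurable_dist_cst.
Qed.

Lemma piece_sub i : A i `<=` O.
Proof. by move=> x []. Qed.

Lemma measurable_energy_piece i : measurable_fun (A i) (fun x => (G x)%:E).
Proof.
apply/measurable_EFinP; apply: measurable_funS measurable_energy => //; exact: piece_sub.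
Qed.

(* The point is chosen with [G x1 <= (average of G over the piece) + 1]; the slack [1]
   avoids discussing when the average is attained and costs [mu O] in total. *)
Lemma piece_value i : exists q, dY y q <= value_bound i /\
  (\int[mu]_(x in A i) (Phi (dY (u x) q / (delta * (k + k))))%:E
     <= \int[mu]_(x in A i) (G x + 1)%:E)%E.
Proof.
have [d0 [dE [ds dt]]] := Ym.
have mA : measurable (A i) by exact: mi.
have mE q : measurable_fun (A i) (fun x => (Phi (dY (u x) q / (delta * (k + k))))%:E).
  apply: (measurable_funS mO (@piece_sub i)); apply: measurable_Nfun_EFin => //.
  under eq_fun do rewrite ds.
  exact: measurable_dist_cst.
have mG1 : measurable_fun (A i) (fun x => (G x + 1)%:E).
  apply/measurable_EFinP; apply: measurable_funD; last exact: measurable_cst.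
  by apply/measurable_EFinP; exact: measurable_energy_piece.
have [A0|A0] := eqVneq (mu (A i)) 0%E.
  exists y; split.
    rewrite (_ : dY y y = 0); last exact/dE.
    by apply: mulr_ge0; [exact: ltW | rewrite le_max ler01].
  apply: ae_ge0_le_integral => //.
  - by move=> x _; rewrite lee_fin Nfun_ge0.
  - by move=> x _; rewrite lee_fin addr_ge0 // energy_ge0.
  have nA : mu.-negligible (A i) by exact/negligibleP.
  by apply: negligibleS nA => x /= /not_implyP[].
have Afin : mu (A i) = (fine (mu (A i)))%:E.
  rewrite fineK // ge0_fin_numE //; apply: le_lt_trans finO.
  by apply: le_measure; rewrite ?inE //; exact: piece_sub.
set m := fine (mu (A i)) in Afin.
have m0 : 0 < m by rewrite -lte_fin -Afin lt0e A0 measure_ge0.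
have IGle : (\int[mu]_(x in A i) (G x)%:E <= 2%:E)%E.
  apply: le_trans integral_energy_le; apply: ge0_subset_integral => //.
  - by apply/measurable_EFinP; exact: measurable_energy.
  - by move=> x _; rewrite lee_fin energy_ge0.
  - exact: piece_sub.
have IG0 : (0 <= \int[mu]_(x in A i) (G x)%:E)%E.
  by apply: integral_ge0 => x _; rewrite lee_fin energy_ge0.
have IGE : (\int[mu]_(x in A i) (G x)%:E = (fine (\int[mu]_(x in A i) (G x)%:E))%:E)%E.
  by rewrite fineK // ge0_fin_numE // (le_lt_trans IGle) // ltry.
set IG := fine _ in IGE.
have IG2 : IG <= 2 by rewrite -lee_fin -IGE.
have IG00 : 0 <= IG by rewrite -lee_fin -IGE.
(* Otherwise integrating over the piece would give [IG + m <= IG]. *)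
have [x1 [Ax1 Nx1 Gx1]] : exists x, [/\ A i x, ~ N x & G x <= IG / m + 1].
  apply: contrapT => /forallNP h.
  have : (((IG / m + 1) * m)%:E <= IG%:E)%E.
    rewrite EFinM -Afin -integral_cst // -IGE; apply: ae_ge0_le_integral => //.
    - by move=> x _; rewrite lee_fin addr_ge0 // divr_ge0 // ltW.
    - by move=> x _; rewrite lee_fin energy_ge0.
    - exact: measurable_energy_piece.
    apply: negligibleS negN => x /= /not_implyP[Ax] /negP; rewrite lee_fin -ltNge => Gx.
    by apply: contrapT => Nx; apply: (h x); split => //; exact: ltW.
  by rewrite lee_fin mulrDl divfK ?lt0r_neq0 //; lra.
have Ox1 := piece_sub Ax1; exists (u x1); split.
  rewrite /value_bound -/m mulrC -ler_pdivrMr // le_max.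
  have [//|t1] := leP (dY y (u x1) / k) 1; apply/orP; right.
  rewrite ler_pdivlMr ?Nfun_gt0 ?oner_neq0 //.
  have t1' : 1 <= `|dY y (u x1) / k| by rewrite (le_trans (ltW t1)) // ler_norm.
  have tpos : 0 <= dY y (u x1) / k by rewrite divr_ge0 // ltW.
  have := Nfun_linear NPhi t1'; rewrite ger0_norm // => h.
  apply: (le_trans h); apply: (@le_trans _ _ (G x1)); first by rewrite lerDr Nfun_ge0.
  by apply: (le_trans Gx1); rewrite lerD2r ler_wpM2r // invr_ge0 ltW.
(* The Hajlasz inequality cancels [delta], and convexity splits the scale [k + k] into two halves.
   The integral is [IG / 2 + (IG + m) / 2], at most [IG + m]. *)
apply: (@le_trans _ _ (\int[mu]_(x in A i) (2^-1%:E * (G x)%:E + (2^-1 * (IG / m + 1))%:E))%E).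
  apply: ae_ge0_le_integral => //.
  - by move=> x _; rewrite lee_fin Nfun_ge0.
  - move=> x _; rewrite lee_fin addr_ge0 // mulr_ge0 ?energy_ge0 ?addr_ge0 //.
    by rewrite divr_ge0 // ltW.
  - apply: emeasurable_funD; last exact: measurable_cst.
    by apply: measurable_funeM; exact: measurable_energy_piece.
  apply: negligibleS negN => x /= /not_implyP[Ax nle]; apply: contrapT => Nx; apply: nle.
  rewrite lee_fin.
  have Ox := piece_sub Ax.
  have dx : dX x x1 <= delta.
    by apply: diam => //; have [_ /= ->] := Ax; have [_ /= ->] := Ax1.
  have h1 : dY (u x) (u x1) / (delta * (k + k)) <= (g x + g x1) / (k + k).
    rewrite ler_pdivrMr ?mulr_gt0 ?addr_gt0 //.
    apply: (le_trans (haj Ox Ox1 Nx Nx1)).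
    apply: (le_trans (ler_wpM2r (addr_ge0 (g0 x) (g0 x1)) dx)).
    rewrite le_eqVlt; apply/orP; left; apply/eqP; field.
    by rewrite lt0r_neq0 // addr_gt0.
  have h2 : Phi (dY (u x) (u x1) / (delta * (k + k))) <= Phi ((g x + g x1) / (k + k)).
    apply: Nfun_mono => //; rewrite !ger0_norm //.
      by rewrite divr_ge0 ?addr_ge0 // ltW.
    by rewrite divr_ge0 // mulr_ge0 ?addr_ge0 // ltW.
  apply: (le_trans h2); apply: (le_trans (Nfun_divD NPhi _ _ k0 k0)).
  have -> : k / (k + k) = 2^-1 by field; rewrite ?lt0r_neq0 ?addr_gt0.
  have a1 : Phi (g x / k) <= G x by rewrite lerDl Nfun_ge0.
  have a2 : Phi (g x1 / k) <= IG / m + 1 by apply: le_trans Gx1; rewrite lerDl Nfun_ge0.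
  by rewrite lerD // ler_wpM2l.
rewrite ge0_integralD //; first last.
- by move=> x _; rewrite lee_fin mulr_ge0 // addr_ge0 // divr_ge0 // ltW.
- by apply: measurable_funeM; exact: measurable_energy_piece.
- by move=> x _; rewrite lee_fin mulr_ge0 // energy_ge0.
rewrite ge0_integralZl_EFin //; first last.
- exact: measurable_energy_piece.
- by move=> x _; rewrite lee_fin energy_ge0.
under [X in (_ <= X)%E]eq_integral => x _ do rewrite EFinD.
rewrite ge0_integralD //; first last.
- exact: measurable_energy_piece.
- by move=> x _; rewrite lee_fin energy_ge0.
rewrite !integral_cst // IGE Afin -!EFinM -!EFinD lee_fin.
rewrite mul1r -mulrA mulrDl divfK ?lt0r_neq0 //; lra.
Qed.

(** Summed over the pieces, the energy contributes at most [2] and the slack [mu O];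
    [modular_le1_scale] turns this bound on the modular into the factor of the scale. *)
Lemma step_approximation : exists q : nat -> Y, (forall i, dY y (q i) <= value_bound i) /\
  (modular mu Phi O (fun x => dY (u x) (q (iota x))) ((2 + fine (mu O)) * (delta * (k + k))) <= 1)%E.
Proof.
have [d0 [dE [ds dt]]] := Ym.
have /choice[q qP] := piece_value.
exists q; split; first by move=> i; exact: (qP i).1.
have sq : step_map O (fun x => q (iota x)) by exists iota, q.
have mE : measurable_fun O (fun x => dY (u x) (q (iota x))) by exact: step_map_dist.
have Of : mu O = (fine (mu O))%:E by rewrite fineK // ge0_fin_numE.
have mG1 : measurable_fun O (fun x => (G x + 1)%:E).
  by apply/measurable_EFinP; apply: measurable_funD; [exact: measurable_energy|exact: measurable_cst].
apply: modular_le1_scale => //.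
- by rewrite mulr_gt0 // addr_gt0.
- by have := @fine_ge0 _ (mu O) (measure_ge0 _ _); lra.
rewrite /modular (integral_index mi) //; first last.
- by move=> x _; rewrite lee_fin Nfun_ge0.
- exact: measurable_Nfun_EFin.
apply: (@le_trans _ _ (\int[mu]_(x in O) (G x + 1)%:E)%E).
  rewrite (integral_index mi) //; last first.
    by move=> x _; rewrite lee_fin addr_ge0 // energy_ge0.
  apply: lee_nneseries => [i _ _|i _]; first by apply: integral_ge0 => x _; rewrite lee_fin Nfun_ge0.
  apply: le_trans (qP i).2; rewrite le_eqVlt; apply/orP; left; apply/eqP.
  by apply: eq_integral => x; rewrite inE => -[_ /= ->].
under eq_integral => x _ do rewrite EFinD.
rewrite ge0_integralD //; first last.
- by apply/measurable_EFinP; exact: measurable_energy.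
- by move=> x _; rewrite lee_fin energy_ge0.
rewrite integral_cst // mul1e Of EFinD; apply: leeD => //.
exact: integral_energy_le.
Qed.

End StepApproximation.

(** * Passage to the limit for the maps and their gradients *)

Section LimitMap.
Set Implicit Arguments.
Unset Strict Implicit.
Context {R : realType} {dd : measure_display} {X : measurableType dd}
  (mu : {measure set X -> \bar R}) (Phi : R -> R) (O : set X).
Hypothesis NPhi : N_function Phi.
Hypothesis mO : measurable O.
Hypothesis finO : (mu O < +oo)%E.

Let h : R := 2^-1.
Let hh j : R := h ^+ j * h ^+ j.

Lemma quarter_pow_gt0 j : 0 < hh j.
Proof. by rewrite mulr_gt0 // half_pow_gt0. Qed.

Lemma quarter_pow_le i j : (i <= j)%N -> hh j <= hh i.
Proof.
by move=> ij; apply: ler_pM; [exact: ltW (half_pow_gt0 _)|exact: ltW (half_pow_gt0 _)|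
  exact: half_pow_le|exact: half_pow_le].
Qed.

(* Norm convergence at rate [4^-j] gives almost everywhere convergence at rate [2^-j]. *)
Lemma modular_ae_small (f : nat -> X -> R) : (forall j, measurable_fun O (f j)) ->
  (forall j x, 0 <= f j x) -> (forall j, (modular mu Phi O (f j) (hh j) <= 1)%E) ->
  {ae mu, forall x, O x -> exists J, forall j, (J <= j)%N -> f j x < h ^+ j}.
Proof.
move=> mf f0 fh; have P1 : 0 < Phi 1 by apply: Nfun_gt0 => //; exact: oner_neq0.
have iP : 0 <= (Phi 1)^-1 by rewrite invr_ge0 ltW.
have hj j : 0 < h ^+ j by exact: half_pow_gt0.
have hj0 j := ltW (hj j).
(* Convexity gains a factor [h ^+ j] from scale [hh j] to scale [h ^+ j], which is summable. The
   factor [(Phi 1)^-1] makes the bound [1] mean [Phi (f j x / h ^+ j) < Phi 1], hence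
   [f j x < h ^+ j]. *)
have : {ae mu, forall x, O x -> exists J, forall j, (J <= j)%N ->
    (Phi 1)^-1 * Phi (f j x / h ^+ j) < 1}.
  apply: (@borel_cantelli_lt1 _ _ _ mu O mO _ (Phi 1)^-1) => //.
  - by move=> j; apply: measurable_funM; [exact: measurable_cst|exact: measurable_Nfun].
  - by move=> j x _; rewrite mulr_ge0 // Nfun_ge0.
  move=> j; apply: (@le_trans _ _ (\int[mu]_(x in O)
      (((Phi 1)^-1 * h ^+ j)%:E * (Phi (f j x / hh j))%:E)))%E.
    apply: ge0_le_integral => //.
    - by move=> x _; rewrite lee_fin mulr_ge0 // Nfun_ge0.
    - apply/measurable_EFinP; apply: measurable_funM; first exact: measurable_cst.
      exact: measurable_Nfun.
    - by apply: measurable_funeM; exact: measurable_Nfun_EFin.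
    - move=> x _; rewrite -EFinM lee_fin -mulrA ler_wpM2l //.
      have -> : f j x / h ^+ j = h ^+ j * (f j x / hh j).
        by rewrite /hh; field; rewrite lt0r_neq0.
      by apply: Nfun_scale => //; rewrite -(expr0 h); exact: half_pow_le.
  rewrite ge0_integralZl_EFin //; first last.
  - by rewrite mulr_ge0.
  - exact: measurable_Nfun_EFin.
  - by move=> x _; rewrite lee_fin Nfun_ge0.
  by rewrite -[leRHS]mule1; apply: lee_wpmul2l; [rewrite lee_fin mulr_ge0|exact: fh].
apply: filterS => x fx Ox; have [J fJ] := fx Ox; exists J => j /fJ.
rewrite mulrC ltr_pdivrMr // mul1r => fP; rewrite ltNge; apply/negP => hf.
move: fP; rewrite ltNge => /negP; apply; apply: Nfun_mono => //.
by rewrite normr1 (le_trans _ (ler_norm _)) // ler_pdivlMr // mul1r.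
Qed.

Context {Z : Type} (dZ : Z -> Z -> R).
Hypothesis Zm : is_metric dZ.
Hypothesis Zc : complete_metric dZ.

Lemma step_map_restrict (w : X -> Z) (S : set X) z0 : measurable (O `&` S) -> step_map O w ->
  step_map O (fun x => if `[< S x >] then w x else z0).
Proof.
move=> mS [iota [z [mi wz]]].
(* Index [0] is reserved for the complement of [S]; the old pieces move up by one. *)
exists (fun x => if `[< S x >] then (iota x).+1 else 0%N).
exists (fun i => if i is i'.+1 then z i' else z0); split; last first.
  by move=> x Ox; case: ifP => // _; exact: wz.
case=> [|i].
  rewrite (_ : _ `&` _ = O `\` (O `&` S)); first exact: measurableD.
  apply/seteqP; split=> x [Ox] /=.
    by case: asboolP => // nS _; split => // -[].
  by case: asboolP => // Sx []; split.
rewrite (_ : _ `&` _ = (O `&` S) `&` (O `&` iota @^-1` [set i])); first exact: measurableI.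
apply/seteqP; split=> x.
  by move=> [Ox] /=; case: asboolP => // Sx [].
by move=> [[Ox Sx] [_ /= xi]]; split => //=; case: asboolP => //; rewrite xi.
Qed.

Lemma dist_quad a b c e : `|dZ a b - dZ c e| <= dZ a c + dZ b e.
Proof.
have [_ [_ [ds dt]]] := Zm.
have := dt a c b; have := dt c e b; have := dt c a e; have := dt a b e.
by rewrite (ds c a) (ds e b) ler_distl => h1 h2 h3 h4; apply/andP; split; lra.
Qed.

Lemma limit_map (U w : nat -> X -> Z) : (forall n, mmeasurable dZ O (U n)) ->
  (forall j, step_map O (w j)) ->
  (forall j, exists n0, forall n, (n0 <= n)%N ->
     (modular mu Phi O (fun x => dZ (U n x) (w j x)) (hh j / 2) <= 1)%E) ->
  exists v : X -> Z, [/\ mmeasurable dZ O v,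
    forall n, measurable_fun O (fun x => dZ (U n x) (v x)) &
    forall j, exists n0, forall n, (n0 <= n)%N ->
     (modular mu Phi O (fun x => dZ (U n x) (v x)) (2 * hh j) <= 1)%E].
Proof.
have [d0 [dE [ds dt]]] := Zm; have hh0 := quarter_pow_gt0.
move=> mU sw Uw.
have mUw n j : measurable_fun O (fun x => dZ (U n x) (w j x)) by exact: step_map_dist.
have mww i j : measurable_fun O (fun x => dZ (w i x) (w j x)).
  by apply: step_map_dist => //; exact: step_map_mmeasurable.
(* Both step maps are compared with one common [U n], [n] large. *)
have ww j l : (j <= l)%N -> (modular mu Phi O (fun x => dZ (w j x) (w l x)) (hh j) <= 1)%E.
  move=> jl; have [n1 h1] := Uw j; have [n2 h2] := Uw l.
  have := modularD_le1 NPhi mO (divr_gt0 (hh0 j) (ltr0n _ 2)) (divr_gt0 (hh0 l) (ltr0n _ 2))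
     (mUw _ _) (mUw _ _) (h1 (maxn n1 n2) (leq_maxl _ _)) (h2 (maxn n1 n2) (leq_maxr _ _)).
  apply: le_trans; apply: (@le_trans _ _ (modular mu Phi O (fun x => dZ (w j x) (w l x))
      (hh j / 2 + hh l / 2))).
    apply: modular_le_scale => //; first by rewrite addr_gt0 ?divr_gt0.
    by have := quarter_pow_le jl; lra.
  apply: modular_ae_le => //.
  - by rewrite addr_gt0 ?divr_gt0.
  - by apply: measurable_funD; exact: mUw.
  apply: aeW => x _; rewrite !ger0_norm ?addr_ge0 //=.
  by rewrite (ds _ (w j x)); exact: dt.
have ae_w := modular_ae_small (fun j => mww j j.+1) (fun j x => d0 _ _) (fun j => ww _ _ (leqnSn j)).
(* Since [mu] may be incomplete, almost everywhere convergence is replaced by convergence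
   everywhere: off this measurable set the step maps are reset to a constant. *)
pose S x := exists J, forall j, (J <= j)%N -> dZ (w j x) (w j.+1 x) < h ^+ j.
have mS : measurable (O `&` S).
  rewrite (_ : O `&` S = \bigcup_J \bigcap_(j in [set j | (J <= j)%N])
      (O `&` (fun x => dZ (w j x) (w j.+1 x)) @^-1` `]-oo, h ^+ j[%classic)).
    apply: bigcupT_measurable => J; apply: bigcap_measurable => [|j _]; first by exists J => /=.
    by apply: mww => //; exact: measurable_itv.
  apply/seteqP; split=> [x [Ox [J xJ]]|x [J _ xJ]].
    by exists J => // j /xJ xj; split => //=; rewrite in_itv.
  have [Ox _] := xJ J (leqnn J); split => //; exists J => j /xJ[_ /=].
  by rewrite in_itv.
have z0 : Z := w 0%N point.
pose w' j x := if `[< S x >] then w j x else z0.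
have sw' j : step_map O (w' j) by exact: step_map_restrict.
have /choice[v wv] x : exists l, forall e, 0 < e -> exists N, forall n, (N <= n)%N ->
    dZ (w' n x) l < e.
  rewrite /w'; case: asboolP => [[J xJ]|_]; last first.
    by exists z0 => e e0; exists 0%N => n _; rewrite (_ : dZ z0 z0 = 0) //; exact/dE.
  have [|l /cvg0_natP xl] := @Zc (w ^~ x).
    by apply: (@half_pow_cauchy R Z dZ Zm (w ^~ x) J) => n /xJ /ltW.
  by exists l => e /xl[N hN]; exists N => n /hN; apply: le_lt_trans; exact: ler_norm.
have mv : mmeasurable dZ O v.
  by apply: (limit_mmeasurable Zm sw') => x _ e; exact: wv.
have mUv n : measurable_fun O (fun x => dZ (U n x) (v x)).
  apply: (@measurable_fun_cvg _ _ _ _ (fun j x => dZ (U n x) (w' j x))).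
    by move=> j; exact: step_map_dist.
  move=> x Ox; apply/cvg_natP => e /(wv x)[N hN]; exists N => j /hN.
  apply: le_lt_trans; apply: (le_trans (dist_quad _ _ _ _)).
  by rewrite (_ : dZ (U n x) (U n x) = 0) ?add0r //; exact/dE.
have mwv j : measurable_fun O (fun x => dZ (w j x) (v x)).
  by under eq_fun do rewrite ds; exact: step_map_dist.
have wvk j : (modular mu Phi O (fun x => dZ (w j x) (v x)) (hh j) <= 1)%E.
  (* [maxn j n] makes the bound [ww] available for every [n]. *)
  apply: (@modular_fatou _ _ _ mu Phi O NPhi mO (fun n x => dZ (w j x) (w (maxn j n) x))) => //.
    by move=> n; apply: ww; exact: leq_maxl.
  apply: filterS ae_w => x Sx Ox; apply/cvg_natP => e e0.
  have [N hN] := wv x e e0; exists N => n Nn.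
  have := hN (maxn j n) (leq_trans Nn (leq_maxr _ _)); rewrite /w'.
  case: asboolP => [_|[]]; last exact: Sx.
  apply: le_lt_trans; apply: (le_trans (dist_quad _ _ _ _)).
  by rewrite (_ : dZ (w j x) (w j x) = 0) ?add0r //; exact/dE.
exists v; split => // j; have [n0 hn0] := Uw j; exists n0 => n /hn0 Unw.
have hh20 : 0 < hh j / 2 by rewrite divr_gt0.
have := modularD_le1 NPhi mO hh20 (hh0 j) (mUw _ _) (mwv _) Unw (wvk j).
apply: le_trans; apply: (@le_trans _ _ (modular mu Phi O (fun x => dZ (U n x) (v x))
    (hh j / 2 + hh j))).
  apply: modular_le_scale => //; first by rewrite addr_gt0.
  by have := hh0 j; lra.
apply: modular_ae_le => //.
- by rewrite addr_gt0.
- by apply: measurable_funD.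
by apply: aeW => x _; rewrite !ger0_norm ?addr_ge0 //=.
Qed.

Lemma hajlasz_limit (dX : X -> X -> R) (U : nat -> X -> Z) (v : X -> Z) (g : nat -> X -> R) (N : nat -> set X) k :
  0 < k ->
  (forall n, measurable_fun O (fun x => dZ (U n x) (v x))) ->
  (forall j, exists n0, forall n, (n0 <= n)%N ->
     (modular mu Phi O (fun x => dZ (U n x) (v x)) (2 * hh j) <= 1)%E) ->
  (forall n x, 0 <= g n x) -> (forall n, measurable_fun O (g n)) ->
  (forall n, (modular mu Phi O (g n) k <= 1)%E) ->
  (forall n, mu.-negligible (N n)) ->
  (forall n x x', O x -> O x' -> ~ N n x -> ~ N n x' ->
     dZ (U n x) (U n x') <= dX x x' * (g n x + g n x')) ->
  exists f, hajlasz_gradient dX mu Phi O dZ v f.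
Proof.
have [d0 [dE [ds dt]]] := Zm; have hh0 := quarter_pow_gt0.
move=> k0 mUv Uv g0 mg gk negN haj.
have /choice[tau tauP] j : exists n,
    (modular mu Phi O (fun x => dZ (U n x) (v x)) (hh j) <= 1)%E.
  (* The shift to [j.+1] absorbs the factor [2], as [2 * hh j.+1] is half of [hh j]. *)
  have [n0 /(_ n0 (leqnn _)) Un] := Uv j.+1; exists n0; apply: le_trans Un.
  apply: modular_le_scale => //; first by rewrite mulr_gt0.
  rewrite /hh !exprS (_ : _ * _ = h ^+ j * h ^+ j / 2); last by rewrite /h; field.
  by have := hh0 j; rewrite /hh; lra.
have ae_U := modular_ae_small (fun j => mUv (tau j)) (fun j x => d0 _ _) tauP.
have [f [Nf [f0 mf fk negNf f_lim]]] := convex_limit NPhi mO finO k0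
  (fun j => mg (tau j)) (fun j => g0 (tau j)) (fun j => gk (tau j)).
exists f; split; [by []|split; [split=> //|]].
  by apply: (le_lt_trans (modular_lux k0 fk)); rewrite ltry.
exists (Nf `|` (\bigcup_j N (tau j) `|`
  ~` [set x | O x -> exists J, forall j, (J <= j)%N -> dZ (U (tau j) x) (v x) < h ^+ j])).
split; first by apply: negligibleU => //; apply: negligibleU => //; exact: negligible_bigcup.
move=> x x' Ox Ox' /not_orP[nf /not_orP[nN /contrapT/(_ Ox)[J1 xJ]]].
move=> /not_orP[nf' /not_orP[nN' /contrapT/(_ Ox')[J2 xJ']]].
apply: f_lim => // e e0; have [M hM] := half_pow_lt (divr_gt0 e0 (ltr0n _ 2)).
exists (maxn M (maxn J1 J2)) => j; rewrite !geq_max => /andP[Mj /andP[J1j J2j]].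
have h1 := lt_trans (xJ _ J1j) (hM _ Mj).
have h2 := lt_trans (xJ' _ J2j) (hM _ Mj).
have nNj : ~ N (tau j) x by move=> Nx; apply: nN; exists j.
have nNj' : ~ N (tau j) x' by move=> Nx; apply: nN'; exists j.
have h4 := haj _ _ _ Ox Ox' nNj nNj'.
have := dist_quad (v x) (v x') (U (tau j) x) (U (tau j) x').
rewrite (ds (v x) (U _ _)) (ds (v x') (U _ _)) ler_distl => /andP[_ h5].
lra.
Qed.

End LimitMap.

(** * Nets of uniform size and total boundedness of the images *)

Section UniformNets.
Set Implicit Arguments.
Unset Strict Implicit.
Context {R : realType} (Y : nat -> Type) (d : forall m, Y m -> Y m -> R) (K : forall m, set (Y m)).
Arguments d {m}.
Arguments K : clear implicits.
Hypothesis dmet : forall m, is_metric (@d m).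

(** Centres are moved into [K m], doubling the radius, so that the diameter bound controls their
    distance to [y m]; balls missing [K m] receive [y m]. *)
Lemma inner_nets (y : forall m, Y m) : (forall m, K m (y m)) -> uniformly_compact (@d) K ->
  forall e, 0 < e -> exists N : nat, forall m, exists c : nat -> Y m, (forall i, K m (c i)) /\
    K m `<=` \bigcup_(i in [set i | (i < N)%N]) mball (@d m) (c i) e.
Proof.
move=> Ky [_ uc] e e0; have [N hN] := uc _ (divr_gt0 e0 (ltr0n _ 2)); exists N => m.
have [c Kc] := hN m; have [_ [_ [ds dt]]] := dmet m.
have /choice[c' c'P] i : exists a, K m a /\
    forall b, K m b -> d (c i) b < e / 2 -> d (c i) a < e / 2.
  have [[a [Ka ca]]|nex] := pselect (exists a, K m a /\ d (c i) a < e / 2).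
    by exists a.
  by exists (y m); split => // b Kb cb; case: nex; exists b.
exists c'; split=> [i|a Ka]; first by have [] := c'P i.
have [i /= iN ca] := Kc a Ka; exists i => //; rewrite /mball /= in ca *.
have := dt (c' i) (c i) a; have := (c'P i).2 a Ka ca.
by rewrite (ds (c' i) (c i)); lra.
Qed.

Context (Z : Type) (dZ : Z -> Z -> R) (phi : forall m, Y m -> Z) (T : Type)
  (P : forall m, T -> Y m) (z : T -> Z).
Arguments phi : clear implicits.
Hypothesis Zm : is_metric dZ.
Hypothesis phi_iso : forall m, isometric_embedding (@d m) dZ (phi m).

Lemma eventually_uniform (s : nat -> T) (n : nat) (e : R) :
  (forall t, exists N, forall m, (N <= m)%N -> dZ (phi m (P m t)) (z t) < e) ->
  exists N, forall m i, (N <= m)%N -> (i < n)%N -> dZ (phi m (P m (s i))) (z (s i)) < e.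
Proof.
move=> Pz; elim: n => [|n [N hN]]; first by exists 0%N.
have [M hM] := Pz (s n); exists (maxn N M) => m i; rewrite geq_max => /andP[Nm Mm].
by rewrite ltnS leq_eqVlt => /predU1P[->|iN]; [exact: hM | exact: hN].
Qed.

(** At late stages all net points are uniformly close to their limits [z], which form one finite
    net; the finitely many earlier stages bring their own nets. *)
Lemma images_totally_bounded :
  (forall t e, 0 < e -> exists N, forall m, (N <= m)%N -> dZ (phi m (P m t)) (z t) < e) ->
  (forall e, 0 < e -> exists (n : nat) (s : nat -> T), forall m,
     K m `<=` \bigcup_(i in [set i | (i < n)%N]) mball (@d m) (P m (s i)) e) ->
  totally_bounded dZ (\bigcup_m phi m @` K m).
Proof.
have [_ [_ [ds dt]]] := Zm.
move=> Pz nets e e0; have e20 : 0 < e / 2 by rewrite divr_gt0.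
have [n [s Ks]] := nets _ e20.
have [N hN] := eventually_uniform s n (fun t => Pz t _ e20).
pose ball c := mball dZ c e.
suff [N' [c hc]] : finitely_covered ball (\bigcup_m phi m @` K m) by exists N', c.
have late : finitely_covered ball (\bigcup_(m in [set m | (N <= m)%N]) phi m @` K m).
  exists n, (fun i => z (s i)) => _ [m /= Nm [a Ka <-]].
  have [i /= iN Pa] := Ks m a Ka; exists i => //; rewrite /ball /mball /= in Pa *.
  have := hN m i Nm iN; have := dt (z (s i)) (phi m (P m (s i))) (phi m a).
  by rewrite phi_iso (ds (z _) (phi m (P _ _))); lra.
have early j : (j <= N)%N -> finitely_covered ball (\bigcup_(m in [set m | (m < j)%N]) phi m @` K m).
  elim: j => [_|j IH jN].
    by exists 0%N, (fun=> z (s 0%N)) => x [].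
  have one : finitely_covered ball (phi j @` K j).
    exists n, (fun i => phi j (P j (s i))) => _ [a /Ks[i /= iN Pa] <-]; exists i => //.
    by rewrite /ball /mball /= phi_iso; rewrite /mball /= in Pa; lra.
  have [N' [c hc]] := finitely_coveredU (IH (ltnW jN)) one.
  exists N', c => x [m /= mj Kx]; apply: hc; move: mj; rewrite ltnS leq_eqVlt.
  by move=> /predU1P[mj|mj]; [right; rewrite -mj | left; exists m].
have [N' [c hc]] := finitely_coveredU (early N (leqnn N)) late.
exists N', c => x [m _ Kx]; apply: hc; have [Nm|mN] := leqP N m; first by right; exists m.
by left; exists m.
Qed.

End UniformNets.

Theorem theorem3p1 (R : realType) (dd : measure_display) (X : measurableType dd)
  (dX : X -> X -> R) (mu : {measure set X -> \bar R}) (O : set X) (Phi : R -> R)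
  (Y : nat -> Type) (d : forall m, Y m -> Y m -> R) (K : forall m, set (Y m))
  (u : forall m, X -> Y m) :
  is_metric dX -> complete_metric dX ->
  (forall A, mopen dX A -> measurable A) ->
  doubling dX mu -> bounded_domain dX O ->
  N_function Phi -> Delta' Phi -> nabla2 Phi ->
  local_Poincare dX mu Phi O ->
  (forall m, is_metric (d m) /\ complete_metric (d m)) ->
  (forall m, mcompact (d m) (K m)) ->
  (forall m, M1Phi dX mu Phi O (d m) (u m)) ->
  uniformly_compact d K ->
  (exists y : forall m, Y m, (forall m, K m (y m)) /\
     exists M : R, forall m,
       (lux_norm mu Phi O (fun x => d m (y m) (u m x)) + EH dX mu Phi O (d m) (u m)
          <= M%:E)%E) ->
  exists sigma : nat -> nat, (forall n, (sigma n < sigma n.+1)%N) /\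
  exists (Z : Type) (dZ : Z -> Z -> R) (phi : forall n, Y (sigma n) -> Z)
         (KZ : set Z) (v : X -> Z),
    is_metric dZ /\ complete_metric dZ /\
    (forall n, isometric_embedding (d (sigma n)) dZ (phi n)) /\
    mcompact dZ KZ /\ M1Phi dX mu Phi O dZ v /\
    (forall n, phi n @` K (sigma n) `<=` KZ) /\
        ((fun n => lux_norm mu Phi O (fun x => dZ (phi n (u (sigma n) x)) (v x)))
           @ \oo --> (0 : \bar R)).
Proof.
move=> Xm Xc mop dbl [Onz [Oopen [_ [x0 [r0 Ob]]]]] NPhi _ _ _ Ym _ uM Kuc [y [Ky [M yM]]].
have dm m := (Ym m).1.
have mO := mop _ Oopen.
have finO : (mu O < +oo)%E.
  apply: le_lt_trans (measure_mball_fin Xm dbl x0 r0); apply: le_measure => //; rewrite inE //.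
  exact: measurable_mball.
have tbO : totally_bounded dX O.
  move=> e /(mball_totally_bounded Xm mop dbl x0 r0)[N [c Bc]].
  by exists N, c => x /Ob/Bc.
have u_meas m : mmeasurable (d m) O (u m) by have [[]] := uM m.
have EH0 m : (0 <= EH dX mu Phi O (d m) (u m))%E.
  by apply: le_ereal_inf_tmp => _ [g [_ ->]]; exact: lux_ge0.
have M0 : 0 <= M.
  by rewrite -lee_fin; apply: le_trans (yM 0%N); apply: adde_ge0 => //; exact: lux_ge0.
(* The margin over [M] gives the strict inequalities needed to pick admissible scales and gradients
   from the infima. *)
pose k := M + 1; have k0 : 0 < k by rewrite ltr_wpDl.
have Mk : (M%:E < k%:E)%E by rewrite lte_fin ltrDl.
have uk m : (modular mu Phi O (fun x => d m (y m) (u m x)) k <= 1)%E.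
  apply: (lux_modular NPhi mO _ _).2; first exact: (measurable_dist_cst (dm m)).
  apply: le_lt_trans Mk; apply: le_trans (yM m); exact: leeDl.
have gP m : {gN : (X -> R) * set X | [/\ forall x, 0 <= gN.1 x, measurable_fun O gN.1,
    (modular mu Phi O gN.1 k <= 1)%E, mu.-negligible gN.2 &
    forall x x', O x -> O x' -> ~ gN.2 x -> ~ gN.2 x' ->
      d m (u m x) (u m x') <= dX x x' * (gN.1 x + gN.1 x')]}.
  apply: cid.
  have : (EH dX mu Phi O (d m) (u m) < k%:E)%E.
    apply: le_lt_trans Mk; apply: le_trans (yM m); apply: leeDr; exact: lux_ge0.
  move=> /ereal_inf_lt[_ [g [[g0 [[mg _] [N [negN haj]]]] ->]] gk].
  by exists (g, N); split => //; exact: (lux_modular NPhi mO mg gk).2.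
pose g m := (sval (gP m)).1; pose N m := (sval (gP m)).2.
pose h : R := 2^-1; pose hh j : R := h ^+ j * h ^+ j.
have hh0 j : 0 < hh j by rewrite mulr_gt0 // half_pow_gt0.
pose C := 2 + fine (mu O).
have C0 : 0 < C by have := @fine_ge0 _ (mu O) (measure_ge0 _ _); rewrite /C; lra.
(* Solves [C * (delta j * (k + k)) = hh j / 4], the error of the step approximation. *)
pose delta j := hh j / (4 * C * (k + k)).
have delta0 j : 0 < delta j by rewrite divr_gt0 // !mulr_gt0 // addr_gt0.
have pieces j : {Ni : nat * (X -> nat) | [/\ measurable_index O Ni.2,
    forall x, O x -> (Ni.2 x < Ni.1)%N &
    forall x x', O x -> O x' -> Ni.2 x = Ni.2 x' -> dX x x' <= delta j]}.
  apply: cid; have [n [iota ?]] := small_pieces Xm mop mO tbO (delta0 j).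
  by exists (n, iota).
pose size_ j := (sval (pieces j)).1; pose iota j := (sval (pieces j)).2.
have iota_m j : measurable_index O (iota j) by have [] := svalP (pieces j).
have iota_lt j x : O x -> (iota j x < size_ j)%N by have [_ + _] := svalP (pieces j); apply.
have approx m j : {q : nat -> Y m |
    (forall i, d m (y m) (q i) <= value_bound mu Phi O (iota j) k i) /\
    (modular mu Phi O (fun x => d m (u m x) (q (iota j x))) (hh j / 4) <= 1)%E}.
  apply: cid; have [_ _ diam] := svalP (pieces j).
  have [g0 mg gk negN haj] := svalP (gP m).
  have [q [qy qk]] := step_approximation NPhi mO finO (iota_m j) diam (delta0 j) k0 (dm m)
    (u_meas m) mg g0 gk (uk m) negN haj.
  exists q; split => //; move: qk; congr (modular _ _ _ _ _ <= 1)%E.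
  by rewrite /delta -/C; field; rewrite !lt0r_neq0 // addr_gt0.
pose q m j := sval (approx m j).
have nets j : {N : nat | forall m, exists c : nat -> Y m, (forall i, K m (c i)) /\
    K m `<=` \bigcup_(i in [set i | (i < N)%N]) mball (d m) (c i) (h ^+ j)}.
  by apply: cid; exact: (inner_nets dm Ky Kuc (half_pow_gt0 j)).
have nets_c m j := cid (svalP (nets j) m).
pose c m j := sval (nets_c m j).
(* Labels of all points to be followed: [inl] for step values, [inr] for net points of the [K m],
   indexed by scale and number. *)
pose T : countType := (nat * nat + nat * nat)%type.
pose P m (t : T) := match t with inl (j, i) => q m j i | inr (j, i) => c m j i end.
have [D KD] := Kuc.1.
have P_bound t : exists B, forall m, d m (y m) (P m t) <= B.
  case: t => -[j i].
    by exists (value_bound mu Phi O (iota j) k i) => m; exact: (svalP (approx m j)).1.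
  by exists D => m; apply: KD => //; exact: (svalP (nets_c m j)).1.
have [|sigma [sigma_mono [Z [dZ [phi [z [Zm Zc phi_iso Pz]]]]]]] :=
    @common_embedding R Y d T (inl (0%N, 0%N)) P dm.
  move=> s t; have [B1 h1] := P_bound s; have [B2 h2] := P_bound t.
  exists (B1 + B2) => m; have [_ [_ [ds dt]]] := dm m.
  by apply: (le_trans (dt _ (y m) _)); rewrite (ds _ (y m)) lerD.
exists sigma; split => //.
have [_ [dE [ds dt]]] := Zm.
pose U n x := phi n (u (sigma n) x).
pose w j x := z (inl (j, iota j x) : T).
have mU n : mmeasurable dZ O (U n).
  by move=> A Aop; apply: (u_meas (sigma n) (phi n @^-1` A)); exact: mopen_preimage_isometry (phi_iso n) Aop.
have sw j : step_map O (w j) by exists (iota j), (fun i => z (inl (j, i))).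
have [c1 c10 c1P] := modular_cst NPhi mO finO.
have Uw j : exists n0, forall n, (n0 <= n)%N ->
    (modular mu Phi O (fun x => dZ (U n x) (w j x)) (hh j / 2) <= 1)%E.
  have hh40 : 0 < hh j / 4 by rewrite divr_gt0.
  (* A uniform displacement by [e] has norm at most [hh j / 4]. There being finitely many pieces,
     all values at scale [j] are eventually that close to their limits. *)
  pose e := hh j / 4 / c1; have e0 : 0 < e by rewrite divr_gt0.
  have [n0 hn0] := @eventually_uniform _ _ _ _ phi _ (fun n => P (sigma n)) z
    (fun i => inl (j, i)) (size_ j) e (fun t => Pz t e e0).
  exists n0 => n nn; have [qy qk] := svalP (approx (sigma n) j).
  have sq : step_map O (fun x => phi n (q (sigma n) j (iota j x))).
    by exists (iota j), (fun i => phi n (q (sigma n) j i)).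
  have mE : measurable_fun O (fun x => d (sigma n) (u (sigma n) x) (q (sigma n) j (iota j x))).
    under eq_fun do rewrite -phi_iso.
    exact: (step_map_dist mO Zm (mU n) sq).
  have mc : measurable_fun O (cst e : X -> R) by exact: measurable_cst.
  have ce := c1P e e0; rewrite (_ : c1 * e = hh j / 4) in ce; last first.
    by rewrite /e mulrC divfK // lt0r_neq0.
  have := modularD_le1 NPhi mO hh40 hh40 mE mc qk ce.
  rewrite (_ : hh j / 4 + hh j / 4 = hh j / 2); last by field.
  apply: le_trans; apply: modular_ae_le => //; first by rewrite divr_gt0.
  - exact: step_map_dist.
  - exact: measurable_funD.
  apply: aeW => x Ox; rewrite !ger0_norm /=; last 2 first.
  - by rewrite addr_ge0 //; [exact: (dm _).1 | exact: ltW].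
  - exact: Zm.1.
  have := hn0 n (iota j x) nn (iota_lt j x Ox).
  have := dt (U n x) (phi n (q (sigma n) j (iota j x))) (w j x).
  by rewrite /U phi_iso /w /=; lra.
have [v [mv mUv Uv]] := limit_map NPhi mO Zm Zc mU sw Uw.
have [f fhaj] : exists f, hajlasz_gradient dX mu Phi O dZ v f.
  apply: (@hajlasz_limit _ _ _ mu Phi O NPhi mO finO Z dZ Zm dX U v
    (fun n => g (sigma n)) (fun n => N (sigma n)) k k0 mUv Uv).
  - by move=> n; have [] := svalP (gP (sigma n)).
  - by move=> n; have [] := svalP (gP (sigma n)).
  - by move=> n; have [] := svalP (gP (sigma n)).
  - by move=> n; have [] := svalP (gP (sigma n)).
  - by move=> n x x'; rewrite phi_iso; have [_ _ _ _] := svalP (gP (sigma n)); exact.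
have Kne : \bigcup_n phi n @` K (sigma n) !=set0.
  by exists (phi 0%N (y (sigma 0%N))); exists 0%N => //; exists (y (sigma 0%N)).
have Ktb : totally_bounded dZ (\bigcup_n phi n @` K (sigma n)).
  apply: (@images_totally_bounded R (fun n => Y (sigma n)) (fun n => d (sigma n))
    (fun n => K (sigma n)) Z dZ phi T (fun n => P (sigma n)) z Zm phi_iso Pz) => e e0.
  have [j /(_ j (leqnn j)) hj] := half_pow_lt e0.
  exists (sval (nets j)), (fun i => inr (j, i)) => m a Ka.
  have [i iN ia] := (svalP (nets_c (sigma m) j)).2 a Ka; exists i => //.
  exact: lt_trans ia hj.
have [KZ KZc KZsub] := totally_bounded_compact Zm Zc Kne Ktb.
exists Z, dZ, phi, KZ, v; split=> //; split=> //; split=> //; split=> //.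
split.
  split; last by exists f.
  (* Integrability of [v] is inherited from one [U n0] at finite distance, with the image of its
     base point as reference. *)
  split => //; have [n0 /(_ n0 (leqnn _)) Uvk] := Uv 0%N; exists (phi n0 (y (sigma n0))).
  split; first exact: measurable_dist_cst.
  have hh20 : 0 < 2 * hh 0%N by rewrite mulr_gt0.
  have mdu : measurable_fun O (fun x => d (sigma n0) (y (sigma n0)) (u (sigma n0) x)).
    exact: (measurable_dist_cst (dm _)).
  have := modularD_le1 NPhi mO k0 hh20 mdu (mUv n0) (uk (sigma n0)) Uvk.
  move=> fin; apply: (@le_lt_trans _ _ (k + 2 * hh 0%N)%:E); last by rewrite ltry.
  apply: modular_lux; first by rewrite addr_gt0.
  apply: le_trans fin; apply: modular_ae_le => //; first by rewrite addr_gt0.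
  - exact: measurable_dist_cst.
  - exact: measurable_funD.
  apply: aeW => x Ox; rewrite !ger0_norm /=; last 2 first.
  - by rewrite addr_ge0 //; [exact: (dm _).1 | exact: Zm.1].
  - exact: Zm.1.
  by rewrite -phi_iso; exact: dt.
split; first by move=> n b Kb; apply: KZsub; exists n.
have lux_small j : exists n0, forall n, (n0 <= n)%N ->
    (lux_norm mu Phi O (fun x => dZ (U n x) (v x)) <= (2 * hh j)%:E)%E.
  have [n0 hn0] := Uv j; exists n0 => n /hn0 Un; apply: modular_lux Un.
  by rewrite mulr_gt0.
apply: cvg_EFin.
  have [n0 hn0] := lux_small 0%N; exists n0 => // n /= /hn0 Un.
  by rewrite ge0_fin_numE ?lux_ge0 // (le_lt_trans Un) // ltry.
apply/cvg0_natP => e e0; have [j /(_ j (leqnn j)) hj] := half_pow_lt (divr_gt0 e0 (ltr0n _ 2)).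
have [n0 hn0] := lux_small j; exists n0 => n /hn0 Un /=.
have fin : lux_norm mu Phi O (fun x => dZ (U n x) (v x)) \is a fin_num.
  by rewrite ge0_fin_numE ?lux_ge0 // (le_lt_trans Un) // ltry.
rewrite ger0_norm ?fine_ge0 ?lux_ge0 // -lte_fin fineK //; apply: (le_lt_trans Un).
have h1 : h ^+ j <= 1 by rewrite -(expr0 h); exact: half_pow_le.
have hhh : hh j <= h ^+ j by rewrite ler_piMl // ltW // half_pow_gt0.
by rewrite lte_fin; have := le_lt_trans hhh hj; lra.
Qed.
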